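(* Let $n\ge1$, $N=2n+1$. Let $\prec$ be a total order on $\mathbb{Z}$ invariant under translation ($i\prec j$ implies $i+N\prec j+N$) and negation ($i\prec j$ implies $-j\prec-i$). For integers $i<j$ not divisible by $N$ with $i\not\equiv j\bmod N$ and $i+j\not\equiv N\bmod 2N$, let $\rho(i,j)=\widetilde{e}_j-\widetilde{e}_i$ if $i\not\equiv -j\bmod N$ and $\rho(i,j)=\tfrac12(\widetilde{e}_j-\widetilde{e}_i)$ if $i+j\equiv0\bmod 2N$. Then $\{\rho(i,j): i<j,\ i\succ j,\ i\not\equiv j\bmod N,\ i+j\not\equiv N\bmod 2N\}$ is a biclosed set of $\widetilde{B}_n$, and every biclosed set of $\widetilde{B}_n$ is of this form. Two such total orders give the same biclosed set if and only if they are the same up to (1) reversal on intervals of the form $r+N\mathbb{Z}$ and (2) interchanging neighbors $i$ and $j$ for which $i+j\equiv N\bmod 2N$.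
   Context: Let $V$ be the real vector space spanned by $\widetilde{e}_i$, $i\in\mathbb{Z}$, modulo $\widetilde{e}_{i+N}=\widetilde{e}_i+\widetilde{e}_N$ and $\widetilde{e}_{-i}=-\widetilde{e}_i$. The positive roots of $\widetilde{B}_n$ are $\widetilde{e}_j-\widetilde{e}_i$ for $i<j$, $i,j\not\equiv0\bmod N$, $i\not\equiv\pm j\bmod N$, together with $\tfrac12(\widetilde{e}_j-\widetilde{e}_i)$ for $i<j$, $i+j\equiv0\bmod 2N$. A set $B$ of positive roots is biclosed if for positive roots $\alpha,\beta,\gamma$ with $\gamma\in\mathbb{R}_{>0}\alpha+\mathbb{R}_{>0}\beta$: $\alpha,\beta\in B\Rightarrow\gamma\in B$ and $\alpha,\beta\notin B\Rightarrow\gamma\notin B$. ''Reversal on an interval $r+N\mathbb{Z}$'' means reversing the order restricted to a residue class $r+N\mathbb{Z}$ that forms an interval of the total order; ''neighbors'' means elements adjacent in the total order.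
   Formalization: In the second family of positive roots, ½(ẽ_j − ẽ_i) with i+j ≡ 0 mod 2N, the integers i and j are also required not to be divisible by N; otherwise multiples of ẽ_N would count as roots and the displayed set would not be biclosed. *)

(* Defs.v *)
From HB Require Import structures.
From mathcomp Require Import all_boot all_order all_algebra.
From mathcomp Require Import classical_sets reals.
From mathcomp Require Import zify ring.
From Stdlib Require Relation_Operators.

Set Implicit Arguments.
Unset Strict Implicit.
Unset Printing Implicit Defensive.

Import Order.TTheory GRing.Theory Num.Theory.
Local Open Scope classical_set_scope.
Local Open Scope ring_scope.

Definition period (n : nat) : int := (2 * n + 1)%N%:Z.

Definition etilde_rel (R : realType) (N : int) (W : lmodType R) (w : int -> W)
    : Prop :=
  (forall i, w (i + N) = w i + w N) /\ (forall i, w (- i) = - w i).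

(* (V, e) is the real vector space presented by the generators e_i (i in Z)
   and the relations e_(i+N) = e_i + e_N, e_(-i) = - e_i. The pair is unique up
   to unique isomorphism; etilde_space_exists below shows that it exists. *)
Definition etilde_space (R : realType) (N : int) (V : lmodType R)
    (e : int -> V) : Prop :=
  [/\ etilde_rel N e,
      (forall v : V, exists (s : seq int) (c : int -> R),
          v = \sum_(i <- s) c i *: e i)
    & (forall (W : lmodType R) (w : int -> W), etilde_rel N w ->
          exists f : {linear V -> W}, forall i, f (e i) = w i)].

(* In the second family the condition N does not divide i, j discards the
   multiples of e_N, which are imaginary roots. *)
Definition pos_root (R : realType) (N : int) (V : lmodType R) (e : int -> V)
    : set V :=
  [set a | exists i j : int,
     [/\ i < j, ~~ (N %| i)%Z && ~~ (N %| j)%Z,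
         (i != j %[mod N])%Z, (i != - j %[mod N])%Z & a = e j - e i]] `|`
  [set a | exists i j : int,
     [/\ i < j, ~~ (N %| i)%Z && ~~ (N %| j)%Z,
         (i + j == 0 %[mod 2 * N])%Z & a = 2^-1 *: (e j - e i)]].

Definition biclosed (R : realType) (N : int) (V : lmodType R) (e : int -> V)
    (B : set V) : Prop :=
  B `<=` pos_root N e /\
  forall alpha beta gamma : V,
    pos_root N e alpha -> pos_root N e beta -> pos_root N e gamma ->
    (exists a b : R, [/\ 0 < a, 0 < b & gamma = a *: alpha + b *: beta]) ->
    (B alpha -> B beta -> B gamma) /\ (~ B alpha -> ~ B beta -> ~ B gamma).

Definition invariant_order (N : int) (prec : rel int) : Prop :=
  [/\ irreflexive prec, transitive prec,
      (forall i j, i != j -> prec i j || prec j i),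
      (forall i j, prec i j -> prec (i + N) (j + N))
    & (forall i j, prec i j -> prec (- j) (- i))].

Definition rho_dom (N i j : int) : bool :=
  [&& i < j, ~~ (N %| i)%Z, ~~ (N %| j)%Z,
      (i != j %[mod N])%Z & (i + j != N %[mod 2 * N])%Z].

(* Only used on rho_dom, where i = - j mod N amounts to i + j = 0 mod 2N. *)
Definition rho (R : realType) (N : int) (V : lmodType R) (e : int -> V)
    (i j : int) : V :=
  if (i + j == 0 %[mod 2 * N])%Z then 2^-1 *: (e j - e i) else e j - e i.

Definition inversions (R : realType) (N : int) (V : lmodType R) (e : int -> V)
    (prec : rel int) : set V :=
  [set a | exists i j : int, [/\ rho_dom N i j, prec j i & a = rho N e i j]].

Definition class_interval (N : int) (prec : rel int) (r : int) : Prop :=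
  forall a b c : int, (a = r %[mod N])%Z -> (b = r %[mod N])%Z ->
    prec a c -> prec c b -> (c = r %[mod N])%Z.

Definition neighbors (prec : rel int) (i j : int) : Prop :=
  (prec i j \/ prec j i) /\
  forall k, ~ (prec i k /\ prec k j) /\ ~ (prec j k /\ prec k i).

(* Several intervals are reversed at once: a single reversal of r + NZ breaks
   the invariance under negation unless -r + NZ is reversed too. When q is an
   invariant order, S is necessarily a union of classes, stable under negation. *)
Definition reversal (N : int) (p q : rel int) : Prop :=
  exists S : pred int, (forall r, S r -> class_interval N p r) /\
    forall a b, q a b = if S a && (a == b %[mod N])%Z then p b a else p a b.

(* Likewise, disjoint pairs of neighbors {i, s i} are interchanged at once:
   all translates of a pair must be interchanged together. *)
Definition interchange (N : int) (p q : rel int) : Prop :=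
  exists s : int -> int, [/\ involutive s,
    (forall i, s i != i ->
       neighbors p i (s i) /\ (i + s i = N %[mod 2 * N])%Z)
    & forall a b, q a b = p (s a) (s b)].

Definition order_move (N : int) (p q : rel int) : Prop :=
  [/\ invariant_order N p, invariant_order N q
    & reversal N p q \/ interchange N p q].

Definition same_up_to_moves (N : int) : rel int -> rel int -> Prop :=
  Relation_Operators.clos_refl_sym_trans (rel int) (order_move N).

Definition etilde_model (R : realType) (n : nat) (i : int)
    : {ffun 'I_n -> R^o} * R^o :=
  let N := period n in
  let r := `|(i %% N)%Z|%N in
  ([ffun k : 'I_n => (r == k.+1)%:R - ((r + k.+1)%N == (2 * n + 1)%N)%:R],
   (i %/ N)%Z%:~R + (n < r)%N%:R).

Lemma etilde_space_exists (R : realType) (n : nat) :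
  etilde_space (period n) (@etilde_model R n).
Proof.
have N0 : period n != 0 by rewrite /period; lia.
have Npos : 0 < period n by rewrite /period; lia.
have eN : etilde_model R n (period n) = (0, 1).
  rewrite /etilde_model modzz divzz N0 /= addr0; congr pair.
  apply/ffunP => k; rewrite !ffunE /=.
  have -> : (0 + k.+1)%N == (2 * n + 1)%N = false by have := ltn_ord k; lia.
  by rewrite subrr.
have eadd i : etilde_model R n (i + period n) =
    etilde_model R n i + etilde_model R n (period n).
  rewrite eN /etilde_model modzDr divzDr ?dvdzz // divzz N0 rmorphD /=.
  by congr pair; [rewrite addr0 | rewrite addrAC].
have eopp i : etilde_model R n (- i) = - etilde_model R n i.
  rewrite /etilde_model.
  have Ei := divz_eq i (period n).
  have m0 := modz_ge0 i N0.
  have mN := ltz_pmod i Npos.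
  set q := (i %/ period n)%Z in Ei *; set r := (i %% period n)%Z in Ei m0 mN *.
  have [r0|r0] := eqVneq r 0.
    have Eo : - i = (- q) * period n by rewrite Ei r0; ring.
    rewrite Eo modzMl mulzK // r0 /= !addr0 rmorphN; congr pair => //.
    apply/ffunP => k; rewrite !ffunE /=.
    have -> : (0 + k.+1)%N == (2 * n + 1)%N = false by have := ltn_ord k; lia.
    by rewrite subrr oppr0.
  have Eo : - i = (- q - 1) * period n + (period n - r) by rewrite Ei; ring.
  have b1 : 0 <= period n - r by lia.
  have b2 : period n - r < `|period n| by lia.
  have b2' : (0 <= period n - r < `|period n|) by rewrite b1 b2.
  have Em : (- i %% period n)%Z = period n - r.
    by rewrite Eo modzMDl modz_small.
  have Ed : (- i %/ period n)%Z = - q - 1.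
    by rewrite Eo divzMDl // divz_small // addr0.
  rewrite Em Ed; set s := `|r|%N.
  have sE : r = s by rewrite /s; lia.
  have -> : `|(period n - r)%R|%N = ((2 * n + 1) - s)%N.
    by move: b1; rewrite /period sE; lia.
  have s0 : (0 < s)%N by lia.
  have sN : (s < 2 * n + 1)%N by move: mN; rewrite sE /period; lia.
  congr pair.
    apply/ffunP => k; rewrite !ffunE opprB.
    have kn := ltn_ord k.
    have -> : ((2 * n + 1) - s == k.+1)%N = (s + k.+1 == 2 * n + 1)%N by lia.
    by have -> : ((2 * n + 1) - s + k.+1 == 2 * n + 1)%N = (s == k.+1)%N by lia.
  have -> : (n < (2 * n + 1) - s)%N = ~~ (n < s)%N by lia.
  rewrite rmorphB rmorphN /=; case: (n < s)%N => /=; ring.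
have ebase (k : 'I_n) : etilde_model R n k.+1 =
    ([ffun j : 'I_n => (j == k)%:R], 0).
  have kn := ltn_ord k.
  have b : (0 <= (k.+1 : int) < `|period n|) by rewrite /period; lia.
  rewrite /etilde_model modz_small // divz_small //=.
  have -> : (n < k.+1)%N = false by lia.
  rewrite addr0; congr pair; apply/ffunP => j; rewrite !ffunE.
  have jn := ltn_ord j.
  have -> : (k.+1 + j.+1 == 2 * n + 1)%N = false by lia.
  by rewrite subr0 eqSS eq_sym.
split => //.
- move=> v; exists (period n :: [seq ((k : 'I_n).+1 : int) | k <- enum 'I_n]).
  exists (fun i => if i == period n then v.2 else
    if insub (`|i|.-1)%N is Some k then v.1 k else 0).
  rewrite big_cons eqxx big_map big_enum /= eN.
  rewrite (eq_bigr (fun k : 'I_n => v.1 k *: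
     (([ffun j : 'I_n => (j == k)%:R], 0) : {ffun 'I_n -> R^o} * R^o))); last first.
    move=> k _; rewrite ebase.
    have -> : ((k.+1 : int) == period n) = false.
      by have := ltn_ord k; rewrite /period; lia.
    by rewrite /= valK.
  have -> : v = (v.1, v.2) by case: v.
  rewrite /=.
  have fE : v.1 = \sum_(k < n) v.1 k *: ([ffun j : 'I_n => (j == k)%:R] : {ffun 'I_n -> R^o}).
    apply/ffunP => j; rewrite sum_ffunE (bigD1 j) //= !ffunE eqxx.
    rewrite big1 ?addr0; first by rewrite /GRing.scale /= mulr1.
    by move=> k; rewrite !ffunE eq_sym => /negbTE ->; rewrite scaler0.
  have -> : \sum_(k < n) v.1 k *: (([ffun j : 'I_n => (j == k)%:R], 0)
      : {ffun 'I_n -> R^o} * R^o) = (v.1, 0).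
    rewrite {2}fE.
    elim/big_rec2: _ => // k y1 y2 _ ->.
    by congr pair; rewrite /= scaler0 addr0.
  congr pair; rewrite /= ?scaler0 ?add0r ?addr0 //.
  by rewrite /GRing.scale /= mulr1.
- move=> W w [wadd wopp].
  pose f (v : {ffun 'I_n -> R^o} * R^o) : W :=
    \sum_(k < n) v.1 k *: w k.+1 + v.2 *: w (period n).
  have flin : linear f.
    move=> a x y; rewrite /f /= scalerDr scaler_sumr addrACA -big_split /=.
    congr (_ + _); last by rewrite scalerDl scalerA.
    by apply: eq_bigr => k _; rewrite !ffunE scalerDl scalerA.
  have [F FE] : exists F : {linear ({ffun 'I_n -> R^o} * R^o)%type -> W}, F =1 f.
    pose G : {linear ({ffun 'I_n -> R^o} * R^o)%type -> W} :=
      HB.pack f (GRing.isLinear.Build _ _ _ _ f flin).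
    by exists G.
  exists F => i; apply: subr0_eq.
  pose u i := F (etilde_model R n i) - w i.
  have uadd j : u (j + period n) = u j + u (period n).
    by rewrite /u eadd linearD wadd opprD addrACA.
  have uopp j : u (- j) = - u j by rewrite /u eopp linearN wopp opprD.
  have uN : u (period n) = 0.
    rewrite /u eN FE /f /= scale1r big1 ?add0r ?subrr // => k _.
    by rewrite ffunE scale0r.
  have uk (k : nat) : (k < n)%N -> u k.+1 = 0.
    move=> kn; rewrite /u (ebase (Ordinal kn)) FE /f /= scale0r addr0.
    rewrite (bigD1 (Ordinal kn)) //= ffunE eqxx scale1r big1 ?addr0 ?subrr //.
    by move=> j /negbTE jk; rewrite ffunE jk scale0r.
  have u0 : u 0 = 0.
    have := uopp 0; rewrite oppr0 => /eqP; rewrite -addr_eq0 -mulr2n.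
    by rewrite -scaler_nat scaler_eq0 pnatr_eq0 => /eqP.
  have uper j : u (j + period n) = u j by rewrite uadd uN addr0.
  have umul (q : int) j : u (j + q * period n) = u j.
    elim: q j => [|q IH|q IH] j; first by rewrite mul0r addr0.
      by rewrite -addn1 PoszD mulrDl mul1r addrA uper IH.
    rewrite -[RHS](IH j) -[LHS]uper; congr u.
    by rewrite -addn1 PoszD; ring.
  rewrite -/(u i) (divz_eq i (period n)) addrC umul.
  have m0 := modz_ge0 i N0.
  have mN := ltz_pmod i Npos.
  move: (i %% period n)%Z m0 mN => [[|r]|//] _ rN; first exact: u0.
  have [rn|nr] := ltnP r n; first exact: uk.
  have -> : (r.+1 : int) = - ((2 * n - r.+1)%N.+1 : int) + period n.
    by move: rN; rewrite /period; lia.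
  by rewrite uper uopp uk ?oppr0 //; move: rN; rewrite /period; lia.
Qed.

(* Main.v *)
Require Import Defs.
From HB Require Import structures.
From mathcomp Require Import all_boot all_order all_algebra.
From mathcomp Require Import boolp classical_sets reals.
From mathcomp Require Import zify ring lra.
From Stdlib Require Relation_Operators.

Set Implicit Arguments.
Unset Strict Implicit.
Unset Printing Implicit Defensive.

Import Order.TTheory GRing.Theory Num.Theory.
Local Open Scope classical_set_scope.
Local Open Scope ring_scope.

(* Call integers i, j far when i is not congruent to j or -j mod N. Multiples
   of N allowed, the real roots are exactly the e_j - e_i with i, j far: the
   short root (e_j - e_i) / 2 with i + j = 2dN is e_j - e_(dN). So a set B of
   positive roots is a translation- and negation-invariant tournament on far
   pairs, and biclosedness says that no combination of three roots e_b - e_a,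
   a before b, with positive coefficients vanishes.

   For an invariant order, a vanishing combination is examined through the
   coordinates of each residue class and the height e_i |-> i; it always closes
   up to a cycle of the order.

   Conversely, the tournament of B is transitive on pairwise far triples and
   monotone along residue classes. A near pair i, j is ordered by its pivots, the
   elements k far from i with i < k < j in the tournament, and by the usual order
   of integers when it has no pivot. The main point is that pivots never
   disagree, which is seen by comparing with the multiples of N.

   Orders with the same inversions agree on far pairs, hence on pairs having a
   pivot. A residue class without pivots is an interval, so reversing such classes
   makes the two orders agree on congruent pairs. The remaining disagreements
   are pairs i + j = N mod 2N without pivot; the multiples of N then confine i
   and j to one window, where they are neighbors. *)

(** * Far and near pairs of integers *)

Definition far (N i j : int) : bool := ~~ (N %| i - j)%Z && ~~ (N %| i + j)%Z.

Lemma nearP (N i j : int) :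
  reflect (exists m, j = i + m * N \/ j = - i + m * N) (~~ far N i j).
Proof.
rewrite /far negb_and !negbK; apply: (iffP orP).
  case=> /dvdzP[m E]; first by exists (- m); left; lia.
  by exists m; right; lia.
case=> m [] ->; [left|right]; apply/dvdzP; [exists (- m)|exists m]; lia.
Qed.

Lemma near_refl (N i : int) : ~~ far N i i.
Proof. by apply/nearP; exists 0; left; lia. Qed.

Lemma far_neq (N i j : int) : far N i j -> i != j.
Proof. by apply: contraTneq => ->; exact: near_refl. Qed.

Lemma farC (N i j : int) : far N i j = far N j i.
Proof. by rewrite /far -(opprB j i) rpredN (addrC i). Qed.

Lemma near_trans (N i j k : int) : ~~ far N i j -> ~~ far N j k -> ~~ far N i k.
Proof.
move=> /nearP[m Em] /nearP[l El]; apply/nearP.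
case: Em El => -> [] ->; [exists (m + l); left|exists (l - m); right|
  exists (m + l); right|exists (l - m); left]; lia.
Qed.

Lemma far_near (N i j k : int) : far N i k -> ~~ far N i j -> far N j k.
Proof. by move=> fik nij; apply: contraTT fik => /(near_trans nij). Qed.

Lemma farD (N i j c d : int) : far N (i + c * N) (j + d * N) = far N i j.
Proof.
apply/idP/idP => f.
  have f1 : far N i (j + d * N).
    by apply: far_near f _; apply/nearP; exists (- c); left; lia.
  rewrite farC; rewrite farC in f1.
  by apply: far_near f1 _; apply/nearP; exists (- d); left; lia.
have f1 : far N (i + c * N) j.
  by apply: far_near f _; apply/nearP; exists c; left.
rewrite farC; rewrite farC in f1.
by apply: far_near f1 _; apply/nearP; exists d; left.
Qed.

Lemma farN (N i j : int) : far N (- i) (- j) = far N i j.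
Proof. by rewrite /far -!opprD !rpredN. Qed.

Lemma far_zero (N i c : int) : ~~ (N %| i)%Z -> far N (c * N) i.
Proof.
by move=> Ni; apply/negPn/nearP => -[m [] E]; case/dvdzP: Ni;
  [exists (c + m)|exists (m - c)]; lia.
Qed.

Lemma near_zero (N i j : int) : ~~ far N i j -> (N %| i)%Z = (N %| j)%Z.
Proof.
move=> /nearP[m []] ->.
  by rewrite rpredDr // dvdz_mull.
by rewrite rpredDr ?rpredN // dvdz_mull.
Qed.

Lemma far_zeroN (N i j : int) : (N %| i)%Z -> far N i j -> ~~ (N %| j)%Z.
Proof.
move=> /dvdzP[c ->] f; apply/dvdzP => -[d E]; move: f; apply/negP/nearP.
by exists (d - c); left; lia.
Qed.

(** * Tournaments on far pairs *)

(** Equivalently, [f] is constant or the indicator of a half-line; the direction is left open. *)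
Definition cut (f : pred int) : Prop :=
  forall h1 h2 h3, h1 < h2 -> h2 < h3 -> f h1 = f h3 -> f h2 = f h1.

(** Intervals with the same sum of endpoints are nested, so an endpoint of one lies between the
    endpoints of the other, where [f] takes the opposite value. *)
Lemma cut_cross (f : pred int) s t u v :
  cut f -> f s -> f t -> ~~ f u -> ~~ f v -> s + t = u + v -> False.
Proof.
move=> cf.
wlog st : s t / s <= t.
  move=> wl fs ft fu fv E; have [st|ts] := leP s t; first exact: (wl s t).
  by apply: (wl t s) => //; lia.
wlog uv : u v / u <= v.
  move=> wl fs ft fu fv E; have [st'|ts] := leP u v; first exact: (wl u v).
  by apply: (wl v u) => //; lia.
move=> fs ft fu fv E.
have su : s != u by apply: contraNneq fu => <-.
have tv : t != v by apply: contraNneq fv => <-.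
have sv : s != v by apply: contraNneq fv => <-.
have tu : t != u by apply: contraNneq fu => <-.
have [s_u|u_s] : s < u \/ u < s by lia.
  have := @cf s u t s_u; rewrite fs ft (negbTE fu) => H.
  by have : false = true by apply: H => //; lia.
have := @cf u s v u_s; rewrite fs (negbTE fu) (negbTE fv) => H.
by have : true = false by apply: H => //; lia.
Qed.

Lemma cut_periodic (f : pred int) t :
  cut f -> t != 0 -> (forall c, f (c + t) = f c) -> forall c d, f c = f d.
Proof.
move=> cf; wlog t0 : t / 0 < t.
  move=> wl tn ft; have [t0|t0] : 0 < t \/ 0 < - t by lia.
    exact: (wl t).
  by apply: (wl (- t)) => //; [lia|move=> c; rewrite -ft; congr f; lia].
move=> _ ft c d; have t1 : 1 <= t by lia.
have fm (m : nat) e : f (e + m%:Z * t) = f e.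
  elim: m e => [|m IH] e; first by congr f; lia.
  by rewrite -(IH e) -(ft (e + m%:Z * t)); congr f; lia.
have [m [lo hi]] : exists m : nat, c - d < m%:Z /\ d - c < m%:Z.
  by exists `|c - d|.+1; lia.
have fl : f (d - m%:Z * t) = f d by rewrite -(fm m) subrK.
rewrite -[RHS]fl; apply: (cf _ _ (d + m%:Z * t)).
- by have := ler_peMr (ler0n _ m) t1; lia.
- by have := ler_peMr (ler0n _ m) t1; lia.
- by rewrite fl fm.
Qed.

(** The properties shared by an invariant order and by the tournament of a biclosed set. Members of
    one class are never far from each other, so monotonicity along a class is expressed by
    [far_cut], as seen from an element outside it. *)
Record far_order (N : int) (r : rel int) : Prop := FarOrder {
  far_tot : forall i j, far N i j -> r j i = ~~ r i j;
  far_shift : forall i j c, far N i j -> r (i + c * N) (j + c * N) = r i j;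
  far_opp : forall i j, far N i j -> r (- j) (- i) = r i j;
  far_tr : forall i j k, far N i j -> far N j k -> far N i k ->
    r i j -> r j k -> r i k;
  far_cut : forall i k, far N i k -> cut (fun h => r i (k + h * N)) }.

(* [lia] diverges on irrelevant boolean hypotheses, on which it case-splits. *)
Ltac intlia := repeat match goal with h : is_true _ |- _ => clear h end; lia.

Section Extension.
Variables (N : int) (r : rel int) (H : far_order N r).

Let tr := far_tr H.
Let tot := far_tot H.

Lemma far_irr i j : far N i j -> r i j -> r j i -> False.
Proof. by move=> f rij; rewrite tot // rij. Qed.

Lemma far_shiftE i j c i' j' : far N i j -> i' = i + c * N -> j' = j + c * N ->
  r i' j' = r i j.
Proof. by move=> f -> ->; exact: far_shift. Qed.

Lemma far_oppE i j c i' j' : far N i j -> i' = - j + c * N -> j' = - i + c * N ->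
  r i' j' = r i j.
Proof.
by move=> f -> ->; rewrite (far_shift H) ?(far_opp H f) // farN farC.
Qed.

Lemma farDr i k h : far N i (k + h * N) = far N i k.
Proof. by have := farD N i k 0 h; rewrite mul0r addr0. Qed.

(* On a cycle i, k, j, k' all of whose consecutive pairs are far, every multiple
   of N that is far from the cycle lies on the same side of its four elements. *)
Lemma far_order_acyclic i j k k' : ~~ far N i j -> far N i k -> far N i k' ->
  r i k -> r k j -> r j k' -> r k' i -> False.
Proof.
move=> nij fik fik' rik rkj rjk' rki'.
have fjk := far_near fik nij; have fjk' := far_near fik' nij.
have fki : far N k i by rewrite farC.
have fki' : far N k' i by rewrite farC.
have fkj : far N k j by rewrite farC.
have fkj' : far N k' j by rewrite farC.
have [fkk'|nkk'] := boolP (far N k k').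
  have fk'k : far N k' k by rewrite farC.
  have [rkk'|] := boolP (r k k').
    by apply: (@far_irr i k) => //; exact: (tr fkk' fki').
  rewrite -tot // => rk'k.
  by apply: (@far_irr j k') => //; exact: (tr fk'k fkj).
(* Translated to comparisons with [i], the four relations put [i] before [k] and [k + (p - m) * N]
   but after [k - m * N] and [k + p * N]; the indices have equal sums. *)
have cross m p : j = i + m * N -> k' = k + p * N -> False.
  move=> Ej Ek; apply: (@cut_cross (fun h => r i (k + h * N)) 0 (p - m) (- m) p);
    rewrite /= ?mul0r ?addr0 //.
  - exact: (far_cut H).
  - by rewrite -(@far_shiftE _ _ m j k') ?farDr //; intlia.
  - by rewrite -tot ?farDr // -(@far_shiftE _ _ m k j) // 1?farC ?farDr //; intlia.
  - by rewrite -Ek -tot.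
  - intlia.
case/nearP: (nij) => m Ej; case/nearP: (nkk') => p Ek.
(* The class of a multiple of [N] is stable under negation: [j] is then a translate of [i] in any
   case, and the reflection about [i] replaces the missing translation when [k'] is a reflected
   [k]. *)
have [/dvdzP[a Ea]|Ni] := boolP (N %| i)%Z.
  have Ej' : exists m, j = i + m * N.
    by case: Ej => ->; [exists m|exists (m - 2 * a)]; intlia.
  case: Ej' => {}m {}Ej; case: Ek => [|Ek]; first exact: cross Ej.
  apply: (@cut_cross (fun h => r i (k + h * N)) 0 (2 * a - p) (- m) (2 * a + m - p));
    rewrite /= ?mul0r ?addr0 //.
  - exact: (far_cut H).
  - by rewrite -(@far_oppE _ _ (2 * a) k' i) ?farDr //; intlia.
  - by rewrite -tot ?farDr // -(@far_shiftE _ _ m k j) // 1?farC ?farDr //; intlia.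
  - by rewrite -tot ?farDr // -(@far_oppE _ _ (2 * a + m) j k') // 1?farC ?farDr //; intlia.
  - intlia.
have [/dvdzP[a Ea]|Nk] := boolP (N %| k)%Z.
  have Ek' : exists p, k' = k + p * N.
    by case: Ek => ->; [exists p|exists (p - 2 * a)]; intlia.
  case: Ek' => {}p {}Ek; case: Ej => [Ej|Ej]; first exact: cross Ej Ek.
  apply: (@cut_cross (fun h => r k (j + h * N)) 0 (2 * a - m) (- p) (2 * a + p - m));
    rewrite /= ?mul0r ?addr0 //.
  - exact: (far_cut H).
  - by rewrite -(@far_oppE _ _ (2 * a) i k) ?farDr //; intlia.
  - by rewrite -tot ?farDr // -(@far_shiftE _ _ p j k') // 1?farC ?farDr //; intlia.
  - by rewrite -tot ?farDr // -(@far_oppE _ _ (2 * a + p) k' i) // 1?farC ?farDr //; intlia.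
  - intlia.
have fz c : [/\ far N (c * N) i, far N (c * N) j, far N (c * N) k & far N (c * N) k'].
  by split; apply: far_zero => //; rewrite -?(near_zero nij) -?(near_zero nkk').
(* The property of being after [c * N] propagates along the cycle, hence around it. *)
have same c : [/\ r (c * N) i = r (c * N) k, r (c * N) k = r (c * N) j
  & r (c * N) i = r (c * N) k'].
  have [fi fj fk fk'] := fz c.
  have s1 : r (c * N) i -> r (c * N) k by move=> s; exact: (tr fi fik).
  have s2 : r (c * N) k -> r (c * N) j by move=> s; exact: (tr fk fkj).
  have s3 : r (c * N) j -> r (c * N) k' by move=> s; exact: (tr fj fjk').
  have s4 : r (c * N) k' -> r (c * N) i by move=> s; exact: (tr fk' fki').
  by split; apply/idP/idP; auto.
have psi x c m' : ~~ (N %| x)%Z -> r (c * N) (x + m' * N) = r ((c - m') * N) x.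
  move=> Nx; rewrite -[RHS](far_shift H m'); last exact: far_zero.
  by congr r; intlia.
have psiN x c m' : ~~ (N %| x)%Z -> r (c * N) (- x + m' * N) = ~~ r ((m' - c) * N) x.
  move=> Nx; rewrite psi ?rpredN // -(far_opp H); last by apply: far_zero; rewrite rpredN.
  rewrite opprK tot; last by rewrite -mulNr; apply: far_zero.
  by congr (~~ r _ _); intlia.
have cst x : ~~ (N %| x)%Z -> cut (fun c => r (c * N) x).
  move=> Nx h1 h2 h3 l1 l2 E.
  have nE c : r (c * N) x = r 0 (x + (- c) * N).
    by have := psi x 0 (- c) Nx; rewrite mul0r => ->; congr r; intlia.
  have f0 : far N 0 x by have := far_zero 0 Nx; rewrite mul0r.
  have o1 : - h3 < - h2 by rewrite ltrN2.
  have o2 : - h2 < - h1 by rewrite ltrN2.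
  by rewrite E !nE; apply: (far_cut H f0 o1 o2); rewrite -!nE -E.
(* A periodic cut is constant, but [neg] makes [c |-> r (c * N) x] take both values. Below, a
   translation of one pair of opposite vertices supplies the period, and a reflection of the other
   the change of value. *)
have abs x m' p' : ~~ (N %| x)%Z -> p' != 0 -> (forall c, r ((c - p') * N) x = r (c * N) x) ->
    (forall c, r (c * N) x = ~~ r ((m' - c) * N) x) -> False.
  move=> Nx p0 per neg.
  have := neg 0; rewrite (@cut_periodic _ p' (cst _ Nx) p0 _ 0 (m' - 0)).
    by case: (r _ _).
  by move=> c /=; rewrite -per; congr r; intlia.
case: Ej => Ej; case: Ek => Ek.
- exact: cross Ej Ek.
- apply: (@abs k p m) => //.
  + by apply: contraTneq rkj => m0; rewrite Ej m0 mul0r addr0 -tot.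
  + move=> c; have [<- _ _] := same (c - m); have [_ -> _] := same c.
    by rewrite Ej psi.
  + by move=> c; rewrite -psiN // -Ek; have [<- _ ->] := same c.
- apply: (@abs i m p) => //.
  + by apply: contraTneq rki' => p0; rewrite Ek p0 mul0r addr0 -tot.
  + move=> c; have [-> _ _] := same (c - p); have [_ _ ->] := same c.
    by rewrite Ek psi.
  + by move=> c; rewrite -psiN // -Ej; have [-> -> _] := same c.
(* With two reflections, [m = p] makes [(k', j)] the mirror image of [(i, k)], against [r j k'];
   otherwise the reflections compose to a translation by a nonzero multiple of [N]. *)
have [mp|mp] := eqVneq m p.
  apply: (@far_irr j k') => //.
  by rewrite (@far_oppE i k p k' j) //; intlia.
apply: (@abs i m (p - m)) => //.
- by apply: contraNneq mp; intlia.
- move=> c; have [_ _ E] := same (p - c); have [E1 E2 _] := same (p - c).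
  have Ni' : r ((p - c) * N) i = ~~ r ((m - (p - c)) * N) i.
    by rewrite E1 E2 Ej psiN.
  have Nk' : r ((p - c) * N) i = ~~ r (c * N) i.
    rewrite E Ek psiN // (_ : p - (p - c) = c); last intlia.
    by have [-> _ _] := same c.
  by rewrite (_ : c - _ = m - (p - c)); [rewrite -[LHS]negbK -Ni' Nk' negbK|intlia].
- by move=> c; rewrite -psiN // -Ej; have [-> -> _] := same c.
Qed.

End Extension.

(** * Extension of a tournament to near pairs *)

Definition pivot (N : int) (r : rel int) (i j : int) : Prop :=
  exists k, [/\ far N i k, r i k & r k j].

Definition extension (N : int) (r : rel int) : rel int := fun i j =>
  if far N i j then r i j
  else `[< pivot N r i j >] || (i < j) && ~~ `[< pivot N r j i >].

Section ExtensionOrder.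
Variables (N : int) (r : rel int) (H : far_order N r).
Let tr := far_tr H.
Let tot := far_tot H.

(** Opposite pivots [k] and [k'] would close the cycle [i, k, j, k'] excluded by
    [far_order_acyclic]. *)
Lemma pivot_asym i j : ~~ far N i j -> pivot N r i j -> pivot N r j i -> False.
Proof.
move=> nij [k [fik rik rkj]] [k' [fjk' rjk' rki']].
apply: (far_order_acyclic H nij fik _ rik rkj rjk' rki').
by apply: (far_near fjk'); rewrite farC.
Qed.

Lemma pivot_shift i j c : ~~ far N i j -> pivot N r i j ->
  pivot N r (i + c * N) (j + c * N).
Proof.
move=> nij [k [fik rik rkj]]; have fkj : far N k j by rewrite farC (far_near fik).
by exists (k + c * N); rewrite farD !(far_shift H).
Qed.

Lemma pivot_opp i j : ~~ far N i j -> pivot N r i j -> pivot N r (- j) (- i).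
Proof.
move=> nij [k [fik rik rkj]]; have fkj : far N k j by rewrite farC (far_near fik).
by exists (- k); rewrite farN farC !(far_opp H).
Qed.

Lemma extension_far i j : far N i j -> extension N r i j = r i j.
Proof. by rewrite /extension => ->. Qed.

Lemma extension_pivot i j : ~~ far N i j -> pivot N r i j -> extension N r i j.
Proof. by rewrite /extension => /negbTE -> /asboolP ->. Qed.

Lemma extension_asym i j : extension N r i j -> extension N r j i -> False.
Proof.
rewrite /extension (farC N j i); have [f|nij] := boolP (far N i j).
  exact: far_irr H _ _ f.
case/orP => [/asboolP pij|/andP[lij /asboolP npji]] /orP[/asboolP|/andP[lji /asboolP]] //.
- exact: pivot_asym.
- by move: (lt_trans lij lji); rewrite ltxx.
Qed.

Lemma extension_tot i j : i != j -> extension N r i j || extension N r j i.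
Proof.
move=> ij; rewrite /extension (farC N j i); have [f|nij] := boolP (far N i j).
  by rewrite (tot f) orbN.
by case: asboolP => _; case: asboolP => _; rewrite /= ?orbT // !andbT; case: ltgtP ij.
Qed.

(** Nearness is transitive, so a cycle of length three has zero, one or three near pairs. With one
    near pair, the third element is a pivot that orders it the other way. With three, no pair of the
    cycle has a pivot, and the integers themselves would form a cycle. *)
Lemma extension_trans : transitive (extension N r).
Proof.
move=> j i k ij jk; have [//|nik] := boolP (extension N r i k).
have ik : i != k.
  by apply: contraNneq nik => E; case: (@extension_asym i j ij); rewrite E.
have {nik} ki : extension N r k i by have := extension_tot ik; rewrite (negbTE nik).
exfalso.
have irr a b : far N a b -> r a b -> r b a -> False := @far_irr N r H a b.
have [fij|nij] := boolP (far N i j).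
  rewrite extension_far // in ij.
  have [fjk|njk] := boolP (far N j k).
    rewrite extension_far // in jk.
    have [fik|nik] := boolP (far N i k).
      rewrite extension_far 1?farC // in ki.
      by apply: (irr i k) => //; exact: (tr fij).
    by apply: (@extension_asym i k) => //; apply: extension_pivot => //; exists j.
  have fik : far N i k by rewrite farC; apply: (far_near _ njk); rewrite farC.
  rewrite extension_far 1?farC // in ki.
  apply: (@extension_asym j k) => //; apply: extension_pivot.
    by apply: contra njk; rewrite farC.
  by exists i; rewrite farC.
have [fjk|njk] := boolP (far N j k).
  rewrite extension_far // in jk.
  have fik : far N i k by apply: (far_near fjk); rewrite farC.
  rewrite extension_far 1?farC // in ki.
  apply: (@extension_asym i j) => //; apply: extension_pivot.
    by apply: contra nij; rewrite farC.
  by exists k.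
have nik := near_trans nij njk.
(* A pivot [d] of [a, b] is also far from [c]; according to its position it is a pivot of [a, c] or
   of [c, b], against the assumed order of that pair. *)
have key a b c : ~~ far N a b -> ~~ far N b c -> extension N r b c ->
    extension N r c a -> ~ pivot N r a b.
  move=> nab nbc bc ca [d [fad rad rdb]].
  have fcd : far N c d by apply: (far_near fad); exact: near_trans nab nbc.
  have nca : ~~ far N c a by rewrite farC; exact: near_trans nab nbc.
  have ncb : ~~ far N c b by rewrite farC.
  have [rdc|] := boolP (r d c).
    apply: (@extension_asym a c) => //; apply: extension_pivot; first by rewrite farC.
    by exists d.
  rewrite -tot 1?farC // => rcd.
  by apply: (@extension_asym b c) => //; apply: extension_pivot => //; exists d.
have pij := key _ _ _ nij njk jk ki.
have nki : ~~ far N k i by rewrite farC.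
have pjk := key _ _ _ njk nki ki ij.
have pki := key _ _ _ nki nij ij jk.
have lt a b : ~~ far N a b -> extension N r a b -> ~ pivot N r a b -> a < b.
  by rewrite /extension => /negbTE ->; case: asboolP => //= _ /andP[].
by have := lt_trans (lt_trans (lt _ _ nij ij pij) (lt _ _ njk jk pjk)) (lt _ _ nki ki pki);
  rewrite ltxx.
Qed.

Lemma extension_invariant : invariant_order N (extension N r).
Proof.
split.
- by move=> i; apply/negP => ii; exact: (@extension_asym i i).
- exact: extension_trans.
- exact: extension_tot.
- have E a : a + N = a + 1 * N by rewrite mul1r.
  move=> i j; rewrite !E /extension farD.
  have [f|nij] := boolP (far N i j); first by rewrite (far_shift H).
  case/orP => [/asboolP p|/andP[l /asboolP p]].
    by have /asboolP -> := pivot_shift 1 nij p.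
  rewrite ltrD2r l /=; apply/orP; right; apply/asboolPn => q; apply: p.
  have nji : ~~ far N (j + 1 * N) (i + 1 * N) by rewrite farD farC.
  by have := pivot_shift (- 1) nji q; rewrite mulN1r mul1r !addrK.
- move=> i j; rewrite /extension farN (farC N j i).
  have [f|nij] := boolP (far N i j); first by rewrite (far_opp H).
  case/orP => [/asboolP p|/andP[l /asboolP p]].
    by have /asboolP -> := pivot_opp nij p.
  rewrite ltrN2 l /=; apply/orP; right; apply/asboolPn => q; apply: p.
  have nji : ~~ far N (- i) (- j) by rewrite farN.
  by have := pivot_opp nji q; rewrite !opprK.
Qed.

End ExtensionOrder.

(** * Invariant orders and moves *)

Section InvariantOrder.
Variables (N : int) (p : rel int) (Hp : invariant_order N p).

Lemma ord_irr i : p i i = false.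
Proof. by case: Hp => irr *; exact: irr. Qed.

Lemma ord_trans j i k : p i j -> p j k -> p i k.
Proof. by case: Hp => _ tr *; exact: (tr j). Qed.

Lemma ord_tot i j : i != j -> p j i = ~~ p i j.
Proof.
move=> ij; case: Hp => irr tr tot _ _.
have := tot _ _ ij; case pij : (p i j); case pji : (p j i) => //.
by have := tr _ _ _ pij pji; rewrite irr.
Qed.

Lemma ord_asym i j : p i j -> p j i -> False.
Proof. by move=> pij pji; have := ord_trans pij pji; rewrite ord_irr. Qed.

Lemma ord_opp i j : p (- j) (- i) = p i j.
Proof.
case: Hp => _ _ _ _ opp; apply/idP/idP; last exact: opp.
by move=> /opp; rewrite !opprK.
Qed.

Lemma ord_shift i j c : p (i + c * N) (j + c * N) = p i j.
Proof.
have sh a b (m : nat) : p a b -> p (a + m%:Z * N) (b + m%:Z * N).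
  case: Hp => _ _ _ sh _ ab; elim: m => [|m IH]; first by rewrite !mul0r !addr0.
  by have := sh _ _ IH; rewrite -!addrA -{2 4}[N]mul1r -!mulrDl -PoszD addn1.
have shN a b (m : nat) : p (a + - m%:Z * N) (b + - m%:Z * N) -> p a b.
  by move=> /(sh _ _ m); rewrite !mulNr !addrNK.
(* Translation by [- m * N] is translation by [m * N] conjugated with negation. *)
have shN' a b (m : nat) : p a b -> p (a + - m%:Z * N) (b + - m%:Z * N).
  move=> /(fun h => etrans (ord_opp _ _) h) /(sh _ _ m) /(fun h => etrans (ord_opp _ _) h).
  by rewrite !opprD !opprK !mulNr.
have shP a b (m : nat) : p (a + m%:Z * N) (b + m%:Z * N) -> p a b.
  by move=> /(shN' _ _ m); rewrite !mulNr !addrK.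
have [m [->|->]] : exists m : nat, c = m%:Z \/ c = - m%:Z by exists `|c|%N; lia.
  by apply/idP/idP; [exact: shP|exact: sh].
by apply/idP/idP; [exact: shN|exact: shN'].
Qed.

Lemma ord_shiftE i j c i' j' : i' = i + c * N -> j' = j + c * N -> p i' j' = p i j.
Proof. by move=> -> ->; exact: ord_shift. Qed.

Lemma ord_oppE i j c i' j' : i' = - j + c * N -> j' = - i + c * N -> p i' j' = p i j.
Proof. by move=> -> ->; rewrite ord_shift ord_opp. Qed.

Hypothesis N_gt0 : 0 < N.

(** By iterating the comparison of [i] with [i + N], each class is ordered like the integers or in
    the opposite way. *)
Lemma ord_class i m : m != 0 -> p i (i + m * N) = (p i (i + N) == (0 < m)).
Proof.
have up (k : nat) : p i (i + N) -> p i (i + k.+1%:Z * N).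
  move=> pi; elim: k => [|k IH]; first by rewrite mul1r.
  apply: (ord_trans IH); rewrite (@ord_shiftE i (i + N) k.+1) //; lia.
have dn (k : nat) : p (i + N) i -> p (i + k.+1%:Z * N) i.
  move=> pi; elim: k => [|k IH]; first by rewrite mul1r.
  by apply: (ord_trans _ IH); rewrite (@ord_shiftE (i + N) i k.+1) //; lia.
have iN : i != i + N by lia.
have pos (k : nat) : p i (i + k.+1%:Z * N) = p i (i + N).
  have ik : i != i + k.+1%:Z * N by nia.
  apply/idP/idP; last exact: up.
  by apply: contraTT; rewrite -(ord_tot ik) -(ord_tot iN); exact: dn.
move=> m0; have [k [E|E]] : exists k : nat, m = k.+1%:Z \/ m = - k.+1%:Z.
  by exists `|m|.-1%N; lia.
  by rewrite E pos; case: (p _ _).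
have ik : i != i + k.+1%:Z * N by nia.
rewrite E -(@ord_shiftE _ _ k.+1%:Z (i + k.+1%:Z * N) i) //; last by lia.
by rewrite (ord_tot ik) pos; case: (p _ _).
Qed.

Lemma ord_far : far_order N p.
Proof.
split.
- by move=> i j /far_neq ij; exact: ord_tot.
- by move=> *; exact: ord_shift.
- by move=> *; exact: ord_opp.
- by move=> i j k *; exact: (@ord_trans j).
(* If [i] separated the middle element from both outer ones, the steps from [h2] to [h1] and to
   [h3], which have opposite signs, would go the same way in [p], against [ord_class]. *)
move=> i k fik h1 h2 h3 l1 l2 /= E.
have [n12 n21 n32 n23] : [/\ h1 - h2 != 0, h2 - h1 != 0, h3 - h2 != 0 & h2 - h3 != 0].
  by clear -l1 l2; split; lia.
have [o12 o21 o32 o23] : [/\ (0 < h1 - h2) = false, 0 < h2 - h1, 0 < h3 - h2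
  & (0 < h2 - h3) = false].
  by clear -l1 l2; split; lia.
have tot h : p (k + h * N) i = ~~ p i (k + h * N).
  by apply: ord_tot; apply: (@far_neq N); rewrite farDr.
have cl a b : p (k + a * N) (k + b * N) = p k (k + (b - a) * N).
  by apply: (@ord_shiftE _ _ a); intlia.
have abs a b c : p (k + a * N) (k + b * N) -> p (k + b * N) (k + c * N) ->
    (0 < b - a) = (0 < c - b).
  move=> ab bc; have ba : b - a != 0 by apply: contraTneq ab => /subr0_eq ->; rewrite ord_irr.
  have cb : c - b != 0 by apply: contraTneq bc => /subr0_eq ->; rewrite ord_irr.
  move: ab bc; rewrite !cl !ord_class //.
  by move=> /eqP-> /eqP->.
case e1 : (p i (k + h1 * N)) E; case e2 : (p i (k + h2 * N)) => // /esym e3; exfalso.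
  have n2 : p (k + h2 * N) i by rewrite tot e2.
  have := cl h2 h1; rewrite (ord_trans n2 e1) => /esym; rewrite ord_class //.
  have := cl h2 h3; rewrite (ord_trans n2 e3) => /esym; rewrite ord_class //.
  by move=> /eqP->; rewrite o12 o32.
have n1 : p (k + h1 * N) i by rewrite tot e1.
have n3 : p (k + h3 * N) i by rewrite tot e3.
have := cl h1 h2; rewrite (ord_trans n1 e2) => /esym; rewrite ord_class //.
have := cl h3 h2; rewrite (ord_trans n3 e2) => /esym; rewrite ord_class //.
by move=> /eqP->; rewrite o21 o23.
Qed.

(** The reflection about [d * N] reverses [p] and fixes [d * N], so [i] and its image lie on
    opposite sides of the center. *)
Lemma ord_mid i d : ~~ (N %| i)%Z -> p i (2 * d * N - i) = p i (d * N).
Proof.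
move=> Ni; have fi := far_zero d Ni.
have E : p (d * N) (2 * d * N - i) = p i (d * N) by apply: (@ord_oppE _ _ (2 * d)); intlia.
have E' : p (2 * d * N - i) (d * N) = p (d * N) i by apply: (@ord_oppE _ _ (2 * d)); intlia.
have [pid|npid] := boolP (p i (d * N)).
  by apply: (ord_trans pid); rewrite E.
have pdi : p (d * N) i by rewrite (ord_tot (i := i)) // eq_sym (far_neq fi).
apply/negP => H; apply: (@ord_asym i (d * N)) => //.
by apply: (ord_trans H); rewrite E'.
Qed.

(** A third element cannot lie between neighbors, so it does not tell them apart. *)
Lemma neighbors_swap a a' b : a' = a \/ neighbors p a a' -> b != a -> b != a' ->
  p a' b = p a b /\ p b a' = p b a.
Proof.
case=> [->|[_ nb]] // ba ba'; have [n1 n2] := nb b.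
have := ord_tot (i := a) (j := b); have := ord_tot (i := a') (j := b).
rewrite ![_ == b]eq_sym => /(_ ba') -> /(_ ba) ->.
suff -> : p a' b = p a b by [].
rewrite eq_sym in ba; rewrite eq_sym in ba'.
apply/idP/idP => H; apply/negPn/negP; rewrite -(ord_tot) // => H'.
  by apply: n2.
by apply: n1.
Qed.

End InvariantOrder.

(** * Reversal of residue classes *)

Definition reversed (N : int) (p : rel int) (S : pred int) : rel int := fun a b =>
  if S a && (a == b %[mod N])%Z then p b a else p a b.

(** Transitivity survives because an element outside a reversed interval compares in the same way
    with all its members. *)
Lemma reversed_invariant (N : int) (p : rel int) (S : pred int) :
  invariant_order N p -> (forall r, S r -> class_interval N p r) ->
  (forall a b, (a = b %[mod N])%Z -> S a = S b) -> (forall a, S (- a) = S a) ->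
  invariant_order N (reversed N p S).
Proof.
move=> Hp itv Smod Sopp; rewrite /reversed; split.
- by move=> i; rewrite (ord_irr Hp); case: ifP.
- move=> j i k; case: ifP => [/andP[Si /eqP ij]|nij].
    move=> pji; rewrite -(Smod _ _ ij) Si -ij /=; case: ifP => [/eqP ik pkj|ik pjk].
      exact: (ord_trans Hp pkj pji).
    apply/negPn/negP; rewrite -(ord_tot Hp); last by apply: contraFneq ik => ->.
    move=> pki; move: ik; rewrite eq_sym => /eqP; apply.
    exact: (itv i Si j i).
  move=> pij; case: ifP => [/andP[Sj /eqP jk]|njk] pjk.
    have nij' : (i %% N)%Z != (j %% N)%Z.
      by apply/negP => /eqP E; move: nij; rewrite (Smod _ _ E) Sj E eqxx.
    have -> : S i && (i == k %[mod N])%Z = false by rewrite -jk (negbTE nij') andbF.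
    apply/negPn/negP; rewrite -(ord_tot Hp); last by apply: contraNneq nij' => ->; rewrite jk.
    move=> pki; case/negP: nij'; apply/eqP.
    by apply: (itv j Sj k j) => //.
  case: ifP => [/andP[Si /eqP ik]|_]; last exact: (ord_trans Hp pij pjk).
  by move: nij; rewrite Si /= (itv i Si i k j) // eqxx.
- move=> i j ij; rewrite [(j == i %[mod N])%Z]eq_sym.
  have [/eqP E|] := boolP (i == j %[mod N])%Z; last by rewrite !andbF (ord_tot Hp ij) orbN.
  by rewrite (Smod _ _ E) !andbT; case: ifP => _; rewrite (ord_tot Hp ij) ?orbN // orNb.
- move=> i j; rewrite eqz_modDr (Smod (i + N) i) ?modzDr //.
  have E a b : p (a + N) (b + N) = p a b by apply: (ord_shiftE Hp (c := 1)); rewrite mul1r.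
  by rewrite !E.
- move=> i j; rewrite !(ord_opp Hp) Sopp !eqz_mod_dvd opprK [- j + i]addrC.
  have [/dvdzP[c E]|] := boolP (N %| i - j)%Z; last by rewrite !andbF.
  by rewrite (Smod j i) // -(subrK j i) E modzMDl.
Qed.

Section SameInversions.
Variables (N : int) (p q : rel int).
Hypotheses (Hp : invariant_order N p) (Hq : invariant_order N q) (N_gt0 : 0 < N).
Hypothesis pq : forall i j, far N i j -> p i j = q i j.

Let flipped : pred int := fun a => p a (a + N) != q a (a + N).

(** Far comparisons with [z] already decide in which direction each order runs through the class of
    [a]. *)
Lemma flipped_pivot a z m : far N a z -> p a z -> p z (a + m * N) -> ~~ flipped a.
Proof.
move=> faz paz pza; rewrite negbK; apply/eqP.
have fza : far N z (a + m * N) by rewrite farDr farC.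
have m0 : m != 0.
  by apply: contraTneq pza => ->; rewrite mul0r addr0; apply/negP; exact: (ord_asym Hp paz).
have := ord_trans Hp paz pza; rewrite (ord_class Hp N_gt0) //.
rewrite pq // in paz; rewrite pq // in pza.
have := ord_trans Hq paz pza; rewrite (ord_class Hq N_gt0) //.
by move=> /eqP -> /eqP ->.
Qed.

Lemma flipped_mod a b : (a = b %[mod N])%Z -> flipped a = flipped b.
Proof.
move=> /eqP; rewrite eqz_mod_dvd => /dvdzP[c E].
rewrite /flipped (@ord_shiftE _ _ Hp b (b + N) c) 1?(@ord_shiftE _ _ Hq b (b + N) c) //; lia.
Qed.

Lemma flipped_opp a : flipped (- a) = flipped a.
Proof.
have E r : invariant_order N r -> r (- a) (- a + N) = r a (a + N).
  by move=> Hr; apply: (ord_oppE Hr (c := 1)); lia.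
by rewrite /flipped !E.
Qed.

Lemma flipped_interval a : flipped a -> class_interval N p a.
Proof.
move=> Sa a1 a2 c /[dup] Ea1 /eqP; rewrite eqz_mod_dvd => /dvdzP[m1 E1].
move=> /eqP; rewrite eqz_mod_dvd => /dvdzP[m2 E2] p1 p2.
have S1 : flipped a1 by rewrite (flipped_mod Ea1).
have E12 : a2 = a1 + (m2 - m1) * N by lia.
have [f|] := boolP (far N a1 c).
  by rewrite E12 in p2; have := flipped_pivot f p1 p2; rewrite S1.
case/nearP => t [->|Ec]; first by rewrite addrC modzMDl.
have [N1|N1] := boolP (N %| a1)%Z.
  rewrite -Ea1; apply/eqP; rewrite eqz_mod_dvd Ec.
  by rewrite (_ : _ - _ = t * N - 2 * a1) ?rpredB ?dvdz_mull //; lia.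
have f0 : far N 0 a1 by have := far_zero 0 N1; rewrite mul0r.
(* What remains is [c] in the opposite class. By [flipped_pivot], 0 does not separate the class of
   [a1]; the opposite class then lies on the other side of 0, and [c] cannot be between [a1] and
   [a2]. *)
have zero h : p 0 (a1 + h * N) = p 0 a1.
  have fh : far N 0 (a1 + h * N) by rewrite farDr.
  have cross u v : far N 0 u -> far N 0 v -> (exists m, v = u + m * N) -> flipped u ->
      p 0 v -> p 0 u.
    move=> fu fv [m Ev] Su zv; apply/negPn/negP; rewrite -(ord_tot Hp) ?(far_neq fu) //.
    move=> uz; rewrite Ev in zv; rewrite farC in fu.
    by have := flipped_pivot fu uz zv; rewrite Su.
  have Sh : flipped (a1 + h * N) by rewrite (@flipped_mod _ a1) // addrC modzMDl.
  apply/idP/idP; first by apply: cross => //; exists h.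
  by apply: cross => //; exists (- h); lia.
have zc : p c 0 = p 0 a1.
  by rewrite -(zero (- t)); apply: (ord_oppE Hp (c := 0)); lia.
have [z|z] := boolP (p 0 a1).
  by case: (ord_asym Hp (ord_trans Hp z p1)); rewrite zc.
have zc' : p 0 c.
  rewrite (ord_tot Hp (i := c)) ?zc //; apply: contraNneq N1 => c0.
  by rewrite (_ : a1 = t * N) ?dvdz_mull //; lia.
by have := ord_trans Hp zc' p2; rewrite E12 zero (negbTE z).
Qed.

End SameInversions.

(** * Interchange of neighbors *)

Section Interchange.
Variables (N : int) (p q : rel int).
Hypotheses (Hp : invariant_order N p) (Hq : invariant_order N q) (N_gt0 : 0 < N).
Hypothesis pq_far : forall i j, far N i j -> p i j = q i j.
Hypothesis pq_class : forall i j, (N %| i - j)%Z -> p i j = q i j.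

Let differ i j := p i j != q i j.

(** A disagreement requires [j = - i + m * N], and an even [m = 2 * d] is excluded because [ord_mid]
    reduces the pair to the far comparison of [i] with [d * N]. *)
Lemma differP i j : differ i j ->
  ~~ (N %| i)%Z /\ exists d, j = - i + (2 * d + 1) * N.
Proof.
move=> dij.
have [|/nearP[m E]] := boolP (far N i j).
  by move=> /pq_far pq; rewrite /differ pq eqxx in dij.
have nc : ~~ (N %| i - j)%Z.
  by apply: contraNN dij => /pq_class ->.
case: E => E; first by case/negP: nc; rewrite (_ : i - j = - m * N) ?dvdz_mull //; lia.
have Ni : ~~ (N %| i)%Z.
  apply: contraNN nc => /dvdzP[c Ec].
  by rewrite (_ : i - j = (2 * c - m) * N) ?dvdz_mull //; lia.
split=> //; have [d [Ed|Ed]] : exists d : int, m = 2 * d \/ m = 2 * d + 1.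
  by exists (m %/ 2)%Z; lia.
  have Ej : j = 2 * d * N - i by rewrite E Ed addrC.
  move: dij; rewrite /differ Ej (ord_mid Hp) // (ord_mid Hq) // pq_far ?eqxx //.
  by rewrite farC far_zero.
by exists d; rewrite E Ed.
Qed.

Lemma differC i j : differ i j = differ j i.
Proof.
rewrite /differ; have [->//|ij] := eqVneq i j.
by rewrite (ord_tot Hp ij) (ord_tot Hq ij); case: (p i j); case: (q i j).
Qed.

(** If [k] separated [i] and [j], it would impose the same order on them in [p] and in [q]. *)
Lemma differ_far i j k : differ i j -> far N k i -> far N k j -> p k i = p k j.
Proof.
wlog pkj : i j / p k j.
  move=> wl dij fi fj; case pkj : (p k j); first by rewrite (wl i j).
  by case pki : (p k i) => //; rewrite -pki -pkj (wl j i) // differC.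
move=> dij fi fj; rewrite pkj; apply/negPn/negP; rewrite -(ord_tot Hp) ?(far_neq fi) // => pik.
have fi' : far N i k by rewrite farC.
have qij : q i j by apply: (@ord_trans _ _ Hq k); rewrite -pq_far.
by move: dij; rewrite /differ qij (ord_trans Hp pik pkj).
Qed.

Lemma differ_zero i j c : differ i j -> p (c * N) i = p (c * N) j.
Proof.
move=> dij; have [Ni _] := differP dij.
have [Nj _] : ~~ (N %| j)%Z /\ _ := differP (etrans (differC j i) dij).
by apply: differ_far => //; apply: far_zero.
Qed.

(** For [j = - i + (2 * d + 1) * N], the reflection that swaps [i] and [j] also swaps [d * N] and
    [(d + 1) * N]. No multiple of [N] separates [i] from [j], so [i] lies between these two
    multiples. Hence the cut [c |-> p (c * N) i] is not constant and has no nonzero period. *)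
Lemma differ_floor i j h : differ i j ->
  (forall c, p (c * N) i = p (c * N) (i + h * N)) -> h = 0.
Proof.
move=> dij per; have [Ni [d Ej]] := differP dij; apply/eqP/negPn/negP => h0.
have cutf : cut (fun c => p (c * N) i).
  move=> c1 c2 c3 l1 l2 E.
  have f0 : far N 0 i by have := far_zero 0 Ni; rewrite mul0r.
  have E0 c : p (c * N) i = p 0 (i + - c * N).
    by apply: (@ord_shiftE _ _ Hp _ _ c); lia.
  have o1 : - c3 < - c2 by rewrite ltrN2.
  have o2 : - c2 < - c1 by rewrite ltrN2.
  by rewrite E !E0; apply: (far_cut (ord_far Hp N_gt0) f0 o1 o2); rewrite -!E0 -E.
have := cut_periodic cutf h0; move=> cst.
have {}cst c c' : p (c * N) i = p (c' * N) i.
  apply: cst => e; rewrite per; apply: (ord_shiftE Hp (c := h)); lia.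
have := differ_zero d dij; rewrite (cst d (d + 1)).
have -> : p (d * N) j = p i ((d + 1) * N).
  by apply: (ord_oppE Hp (c := 2 * d + 1)); lia.
rewrite (ord_tot Hp (i := i)); first by case: (p i _).
by rewrite eq_sym (far_neq (far_zero _ Ni)).
Qed.

(** Both partners are reflections of [i], hence congruent, and both compare with the multiples of
    [N] as [i] does; [differ_floor] makes their distance zero. *)
Lemma differ_uniq i j j' : differ i j -> differ i j' -> j = j'.
Proof.
move=> dj dj'; have [_ [d Ed]] := differP dj; have [_ [d' Ed']] := differP dj'.
have := @differ_floor j i (2 * d' - 2 * d); rewrite -differC => /(_ dj).
rewrite (_ : j + _ = j'); last by lia.
move=> E; have : 2 * d' - 2 * d = 0.
  by apply: E => c; rewrite -(differ_zero c dj) (differ_zero c dj').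
lia.
Qed.

Lemma differ_neighbors i j : differ i j -> neighbors p i j.
Proof.
move=> dij; have [Ni [d Ej]] := differP dij.
have ij : i != j by apply: contraNneq dij => ->; rewrite (ord_irr Hp) (ord_irr Hq).
have dji : differ j i by rewrite -differC.
(* An element between [a] and [b] is near both by [differ_far], and compares with the multiples of
   [N] as they do; being a translate of [a] or of [b], it equals it. *)
have nb a b k : differ a b -> p a k -> p k b -> False.
  move=> dab pak pkb; have dba : differ b a by rewrite -differC.
  have [|/nearP[m Ek]] := boolP (far N a k).
    move=> fak; have fkb : far N k b.
      have [_ [e Eb]] := differP dab.
      by rewrite farC; apply: (far_near fak); apply/nearP; exists (2 * e + 1); right.
    have := differ_far dab _ fkb; rewrite farC => /(_ fak); rewrite pkb.
    by move=> pka; exact: (ord_asym Hp pak).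
  have zero c : p (c * N) k = p (c * N) a.
    apply/idP/idP => z; last exact: (ord_trans Hp z pak).
    by rewrite (differ_zero c dab); exact: (ord_trans Hp z pkb).
  have [_ [e Eb]] := differP dab.
  case: Ek => Ek.
    have m0 : m = 0 by apply: (differ_floor dab) => c; rewrite -Ek zero.
    by move: pak; rewrite Ek m0 mul0r addr0 (ord_irr Hp).
  have Ek' : k = b + (m - (2 * e + 1)) * N by lia.
  have m0 : m - (2 * e + 1) = 0.
    by apply: (differ_floor dba) => c; rewrite -Ek' zero (differ_zero c dab).
  by move: pkb; rewrite Ek' m0 mul0r addr0 (ord_irr Hp).
split.
  by rewrite (ord_tot Hp ij); case: (p i j); [left|right].
by move=> k; split=> -[]; apply: nb.
Qed.

Lemma interchange_differ : Defs.interchange N p q.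
Proof.
(* The default value [i] makes [s] fix the elements that have no partner. *)
pose s i := xget i [set j | differ i j].
have sE i j : differ i j -> s i = j.
  by move=> dij; apply: (differ_uniq _ dij); exact: (xgetI i (dij : [set k | differ i k] j)).
have sP i : s i != i -> differ i (s i).
  move=> si; have [[j dij]|no] := pselect (exists j, differ i j).
    by rewrite (sE i j).
  by case/eqP: si; rewrite /s xgetPN // => j dij; apply: no; exists j.
have s_inv : involutive s.
  move=> i; have [si|/sP dis] := eqVneq (s i) i; first by rewrite !si.
  by apply: sE; rewrite -differC.
exists s; split => //.
  move=> i /sP dis; split; first exact: differ_neighbors.
  have [_ [d Es]] := differP dis.
  by rewrite Es (_ : i + _ = d * (2 * N) + N) ?modzMDl //; lia.
have snb a : s a = a \/ neighbors p a (s a).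
  by have [|/sP/differ_neighbors] := eqVneq (s a) a; [left|right].
move=> a b; have [<-|ab] := eqVneq a b; first by rewrite (ord_irr Hp) (ord_irr Hq).
have [dab|ndab] := boolP (differ a b).
  have dba : differ b a by rewrite -differC.
  rewrite (sE _ _ dab) (sE _ _ dba) (ord_tot Hp ab).
  by move: dab; rewrite /differ; case: (p a b); case: (q a b).
move: (ndab); rewrite negbK => /eqP <-.
have bsa : b != s a.
  apply: contraNneq ndab => E; rewrite E; apply: sP.
  by rewrite -E eq_sym.
have sab : s b != a by apply: contraNneq bsa => <-; rewrite s_inv.
have ssab : s b != s a by apply: contraNneq ab => E; rewrite -(s_inv a) -E s_inv.
rewrite eq_sym in ab.
(* The two arguments are moved one at a time, each past an element outside its pair of neighbors. *)
have [-> _] := neighbors_swap Hp (snb a) sab ssab.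
rewrite eq_sym in sab; rewrite eq_sym in ab.
by have [_ ->] := neighbors_swap Hp (snb b) ab sab.
Qed.

End Interchange.

(** Two moves suffice: reversing the classes that [p] and [q] run through in opposite directions
    gives [p'], and a single interchange leads from [p'] to [q]. *)
Lemma same_far_moves (N : int) (p q : rel int) : 0 < N ->
  invariant_order N p -> invariant_order N q ->
  (forall i j, far N i j -> p i j = q i j) -> same_up_to_moves N p q.
Proof.
move=> N0 Hp Hq pq.
pose S a := p a (a + N) != q a (a + N).
pose p' := reversed N p S.
have Smod a b : (a = b %[mod N])%Z -> S a = S b by exact: flipped_mod.
have Sopp a : S (- a) = S a by exact: (flipped_opp Hp Hq).
have Sint a : S a -> class_interval N p a by exact: (flipped_interval Hp Hq N0 pq).
have Hp' : invariant_order N p' by apply: reversed_invariant.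
apply: (Relation_Operators.rst_trans _ _ _ p').
  by apply: Relation_Operators.rst_step; split => //; left; exists S.
apply: Relation_Operators.rst_step; split => //; right.
apply: interchange_differ => //.
  move=> i j /[dup] fij /pq <-; rewrite /p' /reversed eqz_mod_dvd.
  by move: fij; rewrite /far => /andP[/negbTE -> _]; rewrite andbF.
move=> i j Nij; rewrite /p' /reversed eqz_mod_dvd Nij andbT.
have [<-|ij] := eqVneq i j; first by rewrite (ord_irr Hp) (ord_irr Hq) if_same.
rewrite (ord_tot Hp ij).
case/dvdzP: Nij => c Ec; have -> : j = i + (- c) * N by lia.
have c0 : - c != 0 by apply: contraNneq ij => c0; rewrite -subr_eq0 Ec; lia.
rewrite !ord_class // /S.
by case: (p i _); case: (q i _); case: (0 < - c).
Qed.

(** The domain of [rho] leaves out the pairs a move can affect: congruent pairs for a reversal,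
    pairs with [i + j = N mod 2N] for an interchange. *)
Lemma move_rho_dom (N : int) (p q : rel int) i j :
  order_move N p q -> rho_dom N i j -> q j i = p j i.
Proof.
move=> [Hp Hq pq] /and5P[lij _ _ nij sij].
case: pq => [[S [_ qE]]|[s [s_inv snb qE]]].
  by rewrite qE eq_sym (negbTE nij) andbF.
have nb a : s a = a \/ neighbors p a (s a).
  by have [|/snb[]] := eqVneq (s a) a; [left|right].
have ji : j != i by rewrite gt_eqF.
have jsi : j != s i.
  apply: contraNneq sij => E; apply/eqP.
  by have [|_ <-] := snb i; rewrite -E.
have sjsi : s j != s i by rewrite (inv_eq s_inv) s_inv.
have sji : s j != i by rewrite (inv_eq s_inv).
rewrite qE.
have [_ ->] := neighbors_swap Hp (nb i) sji sjsi.
rewrite eq_sym in ji; rewrite eq_sym in sji.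
by have [-> _] := neighbors_swap Hp (nb j) ji sji.
Qed.

(** * Linear relations between roots *)

(** The coordinate of [e u] along [e k] modulo [e N], for odd [N]. When [N] divides [k] the two
    terms cancel and it vanishes identically. *)
Definition class_coord (N k u : int) : int := (N %| u - k)%Z%:Z - (N %| u + k)%Z%:Z.

Section Coord.
Variables (N : int).

Lemma coordD k u c : class_coord N k (u + c * N) = class_coord N k u.
Proof.
rewrite /class_coord; congr (Posz (nat_of_bool _) - Posz (nat_of_bool _)).
  by rewrite addrAC rpredDr // dvdz_mull.
by rewrite addrAC rpredDr // dvdz_mull.
Qed.

Lemma coordN k u : class_coord N k (- u) = - class_coord N k u.
Proof. by rewrite /class_coord -opprD rpredN (addrC (- u)) -(opprB u) rpredN opprB. Qed.

Lemma coord_far k u : far N k u -> class_coord N k u = 0.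
Proof.
by rewrite /far -(opprB u) rpredN (addrC k) /class_coord => /andP[/negbTE -> /negbTE ->].
Qed.

Hypothesis N_odd : forall k, (N %| 2 * k)%Z -> (N %| k)%Z.

Lemma coordE k : ~~ (N %| k)%Z -> class_coord N k k = 1.
Proof.
move=> Nk; rewrite /class_coord subrr dvdz0 -mulr2n -mulr_natl.
by rewrite (negbTE (contraNN (@N_odd k) Nk)).
Qed.

Variant coord_spec k u : int -> Prop :=
| CoordPos m of u = k + m * N : coord_spec k u 1
| CoordNeg m of u = - k + m * N : coord_spec k u (- 1)
| CoordFar of far N k u : coord_spec k u 0.

Lemma coordP k u : ~~ (N %| k)%Z -> coord_spec k u (class_coord N k u).
Proof.
move=> Nk; have [f|/nearP[m [E|E]]] := boolP (far N k u).
- by rewrite coord_far //; constructor.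
- by rewrite E coordD coordE //; exact: (@CoordPos _ _ m).
- by rewrite E coordD coordN coordE //; exact: (@CoordNeg _ _ m).
Qed.

End Coord.

Section RootRelations.
Variables (R : realType) (N : int) (V : lmodType R) (e : int -> V).
Hypothesis Ve : etilde_space N e.

Lemma etildeD i c : e (i + c * N) = e i + c%:~R *: e N.
Proof.
have [[add opp] _ _] := Ve.
have up (m : nat) j : e (j + m%:Z * N) = e j + m%:Z%:~R *: e N.
  elim: m j => [|m IH] j; first by rewrite mul0r scale0r !addr0.
  have -> : j + m.+1%:Z * N = j + m%:Z * N + N by lia.
  by rewrite add IH -addrA -addn1 PoszD rmorphD /= scalerDl scale1r.
have [m [->|->]] : exists m : nat, c = m%:Z \/ c = - m%:Z by exists `|c|%N; lia.
  exact: up.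
have := up m (i + - m%:Z * N); rewrite mulNr subrK => ->.
by rewrite rmorphN scaleNr addrK.
Qed.

Lemma etildeN i : e (- i) = - e i.
Proof. by have [[_ opp] _ _] := Ve. Qed.

Lemma root_shift a b c : e (b + c * N) - e (a + c * N) = e b - e a.
Proof. by rewrite !etildeD opprD addrACA subrr addr0. Qed.

Lemma root_opp a b : e (- a) - e (- b) = e b - e a.
Proof. by rewrite !etildeN opprK addrC. Qed.

Section Relation.
Variables (x y z : R) (a b c d f g : int).
Hypothesis rel0 : x *: (e b - e a) + y *: (e d - e c) + z *: (e g - e f) = 0.

(** The universal property of [V] turns [class_coord N k] into a linear form, here applied to
    [rel0]; the height is treated likewise below. *)
Lemma relation_coord k : x * (class_coord N k b - class_coord N k a)%:~R
  + y * (class_coord N k d - class_coord N k c)%:~R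
  + z * (class_coord N k g - class_coord N k f)%:~R = 0.
Proof.
have [_ _ univ] := Ve.
have [|F FE] := univ R^o (fun i => (class_coord N k i)%:~R).
  split=> i; last by rewrite coordN rmorphN.
  have E0 : class_coord N k N = 0.
    by rewrite -[X in class_coord _ _ X]add0r -[X in _ + X]mul1r coordD
      /class_coord sub0r rpredN add0r subrr.
  by rewrite E0 addr0 -[in X in class_coord _ _ (_ + X)](mul1r N) coordD.
have := congr1 F rel0; rewrite linearD linearD !linearZ !linearB linear0 !FE.
by rewrite !rmorphB.
Qed.

Lemma relation_height :
  x * (b - a)%:~R + y * (d - c)%:~R + z * (g - f)%:~R = 0.
Proof.
have [_ _ univ] := Ve.
have [|F FE] := univ R^o (fun i => i%:~R).
  by split=> i; rewrite ?rmorphD ?rmorphN.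
have := congr1 F rel0; rewrite linearD linearD !linearZ !linearB linear0 !FE.
by rewrite !rmorphB.
Qed.

End Relation.
End RootRelations.

(** * Acyclicity of invariant orders on roots *)

Section Acyclic.
Variables (R : realType) (N : int) (V : lmodType R) (e : int -> V).
Hypotheses (N_gt0 : 0 < N) (N_odd : forall k, (N %| 2 * k)%Z -> (N %| k)%Z).
Hypothesis Ve : etilde_space N e.
Variables (p : rel int) (Hp : invariant_order N p).

Let rcoord := relation_coord Ve.
Let rheight := relation_height Ve.

Lemma dvd_half k m : 2 * k = m * N -> exists c, k = c * N /\ m = 2 * c.
Proof.
move=> E; have /dvdzP[c Ec] : (N %| k)%Z by apply: N_odd; rewrite E dvdz_mull.
by exists c; split=> //; nia.
Qed.

(** Coordinate [d] gives [y = z]. Coordinate [b] then leaves two cases, settled by the height. If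
    [g] is in the class of [- b], then [x = 2 * y] and [g = 2 * a - b], so [a] is a multiple of [N]
    and [g], the mirror image of [b] about it, precedes [a]. If [g] is far from [b], then [x = y]
    and [g = a]. *)
Lemma acyclic_path (x y z : R) a b d g :
  0 < x -> 0 < y -> 0 < z -> far N a b -> far N b d -> far N a d -> far N d g ->
  ~~ (N %| b)%Z -> ~~ (N %| d)%Z -> p a b -> p b d -> p d g ->
  x *: (e b - e a) + y *: (e d - e b) + z *: (e g - e d) = 0 -> False.
Proof.
move=> x0 y0 z0 fab fbd fad fdg Nb Nd pab pbd pdg rel.
have yz : y = z.
  have := rcoord rel d.
  rewrite (coord_far (u := b)) 1?farC // (coord_far (u := a)) 1?farC // (coord_far fdg).
  rewrite (coordE N_odd) // !rmorphB /= !rmorph0 rmorph1; lra.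
have h := rheight rel; have Hb := rcoord rel b.
rewrite (coordE N_odd) // (coord_far (u := a)) 1?farC // (coord_far fbd) in Hb.
move: Hb; case: (coordP N_odd g Nb) => [m E|m E|f]; rewrite !rmorphB /= !rmorph0 rmorph1 => Hb.
- by move: x0; lra.
- have xy : x = 2 * y by move: Hb; lra.
  have Eg : g = 2 * a - b.
    have : y * (2 * (b - a) + (g - b))%:~R = 0.
      by rewrite -[RHS]h xy yz !rmorphD /= rmorphM !rmorphN !rmorphD !rmorphN /=; ring.
    by move=> /eqP; rewrite mulf_eq0 gt_eqF //= intr_eq0 => /eqP; intlia.
  have [c [Ec _]] : exists c, a = c * N /\ m = 2 * c by apply: dvd_half; intlia.
  have pga : p g a by rewrite (@ord_oppE _ _ Hp a b (2 * c)) //; intlia.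
  have pbg := ord_trans Hp pbd pdg; have pgb := ord_trans Hp pga pab.
  exact: (ord_asym Hp pbg).
have xy : x = y by lra.
have Eg : g = a.
  have : y * (g - a)%:~R = 0 by rewrite -[RHS]h xy yz !rmorphB; ring.
  by move=> /eqP; rewrite mulf_eq0 gt_eqF //= intr_eq0 => /eqP; intlia.
have pbg := ord_trans Hp pbd pdg; rewrite Eg in pbg.
exact: (ord_asym Hp pab).
Qed.

Lemma acyclic_far (x y z : R) a b d f g :
  0 < x -> 0 < y -> 0 < z -> far N a b -> far N b d -> far N a d -> far N f g ->
  ~~ (N %| b)%Z -> ~~ (N %| d)%Z -> p a b -> p b d -> p f g ->
  x *: (e b - e a) + y *: (e d - e b) + z *: (e g - e f) = 0 -> False.
Proof.
move=> x0 y0 z0 fab fbd fad ffg Nb Nd pab pbd pfg rel.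
(* Only the third root can cancel the coordinate [d]: up to negation it starts in the class of [d],
   and a translation makes it start at [d]. *)
wlog [m Ef] : f g ffg pfg rel / exists m, f = d + m * N.
  move=> wl; have Hd := rcoord rel d.
  rewrite (coord_far (u := b)) 1?farC // (coord_far (u := a)) 1?farC // in Hd.
  rewrite (coordE N_odd) // in Hd; move: Hd.
  case: (coordP N_odd f Nd) => [m E _|m E|f1]; first by apply: (wl f g) => //; exists m.
    case: (coordP N_odd g Nd) => [m' E'|m' E'|f2];
      rewrite !rmorphB /= ?rmorphN /= ?rmorph0 ?rmorph1.
    + by move: y0 z0; lra.
    + move=> _; apply: (wl (- g) (- f)); rewrite ?farN 1?farC ?(ord_opp Hp) //.
        by rewrite (root_opp Ve).
      by exists (- m'); intlia.
    by move: y0 z0; lra.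
  case: (coordP N_odd g Nd) => [m' E'|m' E'|f2];
    rewrite !rmorphB /= ?rmorphN /= ?rmorph0 ?rmorph1.
  + by move: y0 z0; lra.
  + move=> _; apply: (wl (- g) (- f)); rewrite ?farN 1?farC ?(ord_opp Hp) //.
      by rewrite (root_opp Ve).
    by exists (- m'); intlia.
  by move: y0 z0; lra.
apply: (@acyclic_path x y z a b d (g - m * N)) => //.
- by have := farDr N d g (- m); rewrite mulNr => ->; rewrite -(farD N d g m 0) -Ef mul0r addr0.
- by rewrite -(@ord_shiftE _ _ Hp _ _ m f g) //; intlia.
- by rewrite -[RHS]rel -(root_shift Ve d (g - m * N) m) subrK Ef.
Qed.

(** The height gives [y * m + z * h = 0], that is [x * m + z * (m + h) = 0]. But [a] precedes
    [a + m * N] and [a + (m + h) * N], so [m] and [m + h] have the same sign by [ord_class]. *)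
Lemma acyclic_parallel (x y z : R) a b m h :
  0 < x -> 0 < y -> z = y - x -> 0 < z -> p a b -> p b (a + m * N) -> p a (b + h * N) ->
  x *: (e b - e a) + y *: (e (a + m * N) - e b) + z *: (e (b + h * N) - e a) = 0 -> False.
Proof.
move=> x0 y0 zE z0 pab pba pab' rel.
have pam := ord_trans Hp pab pba.
have paa : p a (a + (m + h) * N).
  by apply: (ord_trans Hp pab'); rewrite (@ord_shiftE _ _ Hp b (a + m * N) h) //; intlia.
have n0 k : p a (a + k * N) -> k != 0.
  by apply: contraTneq => ->; rewrite mul0r addr0 (ord_irr Hp).
have E : y * m%:~R + z * h%:~R = 0.
  have NR : (N%:~R : R) != 0 by rewrite intr_eq0 gt_eqF.
  apply: (mulIf NR); rewrite mul0r -[RHS](rheight rel) zE !rmorphB /= !rmorphD /= !rmorphM /=.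
  ring.
have := pam; have := paa; rewrite !(ord_class Hp N_gt0) ?n0 // => /eqP -> /eqP sgn.
have mR : (0 < m%:~R :> R) = (0 < m) by rewrite ltr0z.
have mhR : (0 < (m + h)%:~R :> R) = (0 < m + h) by rewrite ltr0z.
have {n0} m0 := n0 _ pam; have {mR} [m_gt|m_lt] : 0 < m \/ m < 0 by clear -m0; lia.
  move: sgn; rewrite m_gt -mhR rmorphD /= => mh.
  have mp : 0 < m%:~R :> R by rewrite ltr0z.
  by nra.
have mn : m%:~R < 0 :> R by rewrite ltrz0.
have : (m + h)%:~R <= 0 :> R.
  by rewrite leNgt mhR sgn; apply/negP; clear -m_lt; lia.
by rewrite rmorphD /= => mh; nra.
Qed.

(** Coordinate [a] forces, up to negation, [g = a + h * N] and [z = x + y]; then coordinate [b]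
    gives [x = y]. By the height, [f - h * N] is the center of the reflection taking [a] to
    [- a + m * N]. It precedes [a], so the image of [a] precedes it, which closes a cycle through
    [b]. *)
Lemma acyclic_reflected (x y z : R) a b m f g :
  0 < x -> 0 < y -> 0 < z -> far N a b -> far N f g ->
  ~~ (N %| b)%Z -> ~~ (N %| a)%Z -> p a b -> p b (- a + m * N) -> p f g ->
  x *: (e b - e a) + y *: (e (- a + m * N) - e b) + z *: (e g - e f) = 0 -> False.
Proof.
move=> x0 y0 z0 fab ffg Nb Na pab pba pfg rel.
wlog [h Eg] : f g ffg pfg rel / exists h, g = a + h * N.
  move=> wl; have Ha := rcoord rel a; move: Ha.
  rewrite (coord_far fab) coordD coordN (coordE N_odd) //.
  case: (coordP N_odd g Na) => [h E _|h E|f1]; first by apply: (wl f g) => //; exists h.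
    case: (coordP N_odd f Na) => [h' E'|h' E'|f2];
      rewrite !rmorphB /= ?rmorphN /= ?rmorph0 ?rmorph1.
    + by move: x0 y0 z0; lra.
    + move=> _; apply: (wl (- g) (- f)); rewrite ?farN 1?farC ?(ord_opp Hp) //.
        by rewrite (root_opp Ve).
      by exists (- h'); intlia.
    by move: x0 y0 z0; lra.
  case: (coordP N_odd f Na) => [h' E'|h' E'|f2];
    rewrite !rmorphB /= ?rmorphN /= ?rmorph0 ?rmorph1.
  + by move: x0 y0 z0; lra.
  + move=> _; apply: (wl (- g) (- f)); rewrite ?farN 1?farC ?(ord_opp Hp) //.
      by rewrite (root_opp Ve).
    by exists (- h'); intlia.
  by move: x0 y0 z0; lra.
have fb : far N b g by rewrite Eg farDr farC.
have Ha := rcoord rel a; have Hb := rcoord rel b.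
have faf : far N a f by rewrite farC -(farD N f a 0 h) mul0r addr0 -Eg.
rewrite (coord_far fab) coordD coordN (coordE N_odd) // (coord_far faf) Eg coordD in Ha.
rewrite (coordE N_odd) // in Ha.
rewrite (coordE N_odd) // coordD coordN (coord_far (u := a)) 1?farC // (coord_far fb) in Hb.
rewrite !rmorphB /= ?rmorphN /= ?rmorph0 ?rmorph1 in Ha.
have zE : z = x + y by move: Ha; lra.
have xy : x = y.
  move: Hb; case: (coordP N_odd f Nb) => [? _|? _|_];
    by rewrite !rmorphB /= ?rmorphN /= ?rmorph0 ?rmorph1; move: x0 y0; lra.
have Ef : 2 * f = (m + 2 * h) * N.
  have : x * (m * N + 2 * (h * N) - 2 * f)%:~R = 0.
    rewrite -[RHS](rheight rel) zE -xy Eg !rmorphB /= !rmorphD /= !rmorphM /= rmorphN /=; ring.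
  by move=> /eqP; rewrite mulf_eq0 gt_eqF //= intr_eq0 => /eqP; intlia.
have [c [Ec Em]] := dvd_half Ef.
have pfa : p (f - h * N) a by rewrite -(@ord_shiftE _ _ Hp _ _ h f g) //; intlia.
have paf : p (- a + m * N) (f - h * N).
  by rewrite (@ord_oppE _ _ Hp (f - h * N) a m) //; intlia.
have pfb := ord_trans Hp (ord_trans Hp pfa pab) pba.
exact: (ord_asym Hp pfb).
Qed.

(** Modulo [e N] the first two roots add up to [x - y] times [e b - e a]. The third root therefore
    joins the same two classes, in the direction given by the sign of [x - y], and
    [acyclic_parallel] applies. *)
Lemma acyclic_same_class (x y z : R) a b m f g :
  0 < x -> 0 < y -> 0 < z -> far N a b -> far N f g ->
  ~~ (N %| b)%Z -> p a b -> p b (a + m * N) -> p f g ->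
  x *: (e b - e a) + y *: (e (a + m * N) - e b) + z *: (e g - e f) = 0 -> False.
Proof.
move=> x0 y0 z0 fab ffg Nb pab pba pfg rel.
have fba : far N b a by rewrite farC.
have eqn k : (x - y) * (class_coord N k b - class_coord N k a)%:~R
    + z * (class_coord N k g - class_coord N k f)%:~R = 0.
  rewrite -[RHS](rcoord rel k) coordD -(opprB (class_coord N k b)) rmorphN /=; ring.
wlog normal : f g ffg pfg rel eqn / (exists h, g = b + h * N) \/ (exists h, f = b + h * N).
  move=> wl; have Hb := eqn b; move: Hb; rewrite (coordE N_odd) // (coord_far fba) subr0 mulr1.
  have flipped : (exists h, - f = b + h * N) \/ (exists h, - g = b + h * N) -> False.
    apply: wl; rewrite ?farN 1?farC ?(ord_opp Hp) //.
      by rewrite (root_opp Ve).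
    by move=> k; rewrite -[RHS](eqn k) !coordN opprK [- _ + class_coord _ _ g]addrC.
  case: (coordP N_odd g Nb) => [h E _|h E _|fg].
  - by apply: (wl f g) => //; left; exists h.
  - by apply: flipped; right; exists (- h); intlia.
  case: (coordP N_odd f Nb) => [h E _|h E _|ff].
  - by apply: (wl f g) => //; right; exists h.
  - by apply: flipped; left; exists (- h); intlia.
  rewrite subrr mulr0 addr0 => xy.
  have [Nf|Nf] := boolP (N %| f)%Z.
    have Ng := far_zeroN Nf ffg; have := eqn g.
    rewrite xy mul0r add0r (coordE N_odd) // (coord_far (u := f)) 1?farC // subr0 mulr1.
    by move=> zz; move: z0; rewrite zz ltxx.
  have := eqn f; rewrite xy mul0r add0r (coordE N_odd) // (coord_far ffg) sub0r.
  rewrite rmorphN /= mulrN1.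
  by move=> /eqP; rewrite oppr_eq0 gt_eqF.
have classE u : far N b u -> (~~ (N %| a)%Z -> class_coord N a u = 1) ->
    ((N %| a)%Z -> (N %| u)%Z) -> exists k, u = a + k * N.
  move=> fbu; have [/dvdzP[c Ec] _ /(_ isT)/dvdzP[k Ek]|Na /(_ isT) + _] := boolP (N %| a)%Z.
    by exists (k - c); intlia.
  by case: (coordP N_odd u Na) => // k E _; exists k.
have z_neq0 : z != 0 by rewrite gt_eqF.
case: normal => -[h E].
  have fbf : far N b f by rewrite farC -(farD N f b 0 h) mul0r addr0 -E.
  have zE : z = y - x.
    have := eqn b; rewrite E coordD (coordE N_odd) // (coord_far fba) (coord_far fbf).
    by rewrite subr0 !mulr1; lra.
  have [k Ek] : exists k, f = a + k * N.
    apply: classE => // Na; last first.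
      apply/negPn/negP => Nf; have := eqn f.
      have [/dvdzP[c Ec]] := Na; have faf : far N f a by rewrite farC Ec far_zero.
      rewrite (coord_far (u := b)) 1?farC // (coord_far faf) (coordE N_odd) // (coord_far ffg).
      by rewrite subr0 mulr0 add0r sub0r rmorphN /= mulrN1 => /eqP; rewrite oppr_eq0 gt_eqF.
    have := eqn a; rewrite E coordD (coord_far fab) (coordE N_odd) // !sub0r !rmorphN /=.
    move=> Hz; have /eqP : z * (1 - (class_coord N a f)%:~R) = 0 by rewrite -[RHS]Hz zE; ring.
    by rewrite mulf_eq0 (negbTE z_neq0) subr_eq0 -[1]/(1%:~R) eqr_int => /eqP <-.
  apply: (@acyclic_parallel x y z a b m (h - k)) => //.
    by rewrite -(@ord_shiftE _ _ Hp _ _ k f g) //; intlia.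
  rewrite -[RHS]rel -(root_shift Ve a (b + (h - k) * N) k) -Ek (_ : b + _ + _ = g) //; intlia.
have fbg : far N b g by rewrite -(farD N b g h 0) mul0r addr0 -E.
have zE : z = x - y.
  have := eqn b; rewrite E coordD (coordE N_odd) // (coord_far fba) (coord_far fbg).
  by rewrite subr0 sub0r rmorphN /= mulrN1 mulr1; lra.
have [k Ek] : exists k, g = a + k * N.
  apply: classE => // Na; last first.
    apply/negPn/negP => Ng; have := eqn g.
    have [/dvdzP[c Ec]] := Na; have fga : far N g a by rewrite farC Ec far_zero.
    rewrite (coord_far (u := b)) 1?farC // (coord_far fga) (coordE N_odd) //.
    rewrite (coord_far (u := f)) 1?farC //.
    by rewrite subr0 mulr0 add0r subr0 mulr1 => zz; rewrite zz eqxx in z_neq0.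
  have := eqn a; rewrite E coordD (coord_far fab) (coordE N_odd) // sub0r subr0 !rmorphN /=.
  move=> Hz; have /eqP : z * ((class_coord N a g)%:~R - 1) = 0 by rewrite -[RHS]Hz zE; ring.
  by rewrite mulf_eq0 (negbTE z_neq0) subr_eq0 -[1]/(1%:~R) eqr_int => /eqP.
(* The path is read from [b] through [a + m * N] to [b + m * N], the first root being translated by
   [m * N]. *)
apply: (@acyclic_parallel y x z b (a + m * N) m (k - h - m)) => //.
- by rewrite (ord_shift Hp).
- by rewrite -(@ord_shiftE _ _ Hp _ _ h f g) //; intlia.
rewrite (root_shift Ve) (_ : a + _ + _ = g - h * N); last by intlia.
rewrite -(root_shift Ve b (g - h * N) h) subrK -E -[RHS]rel [X in X + _]addrC.
by congr (_ + _).
Qed.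

Definition acyclic_on_roots (r : rel int) : Prop :=
  forall (x y z : R) a b c d f g, 0 < x -> 0 < y -> 0 < z ->
  far N a b -> far N c d -> far N f g -> r a b -> r c d -> r f g ->
  x *: (e b - e a) + y *: (e d - e c) + z *: (e g - e f) <> 0.

(** Some other root must cancel the coordinate [b]. After exchanging the last two roots, negating
    and translating, the second one starts at [b]; the cases are then [a] and [d] far, congruent, or
    opposite. *)
Lemma ord_acyclic : acyclic_on_roots p.
Proof.
move=> x y z a b c d f g x0 y0 z0 fab fcd ffg pab pcd pfg rel.
wlog Nb : a b fab pab rel / ~~ (N %| b)%Z.
  move=> wl; have [Nb|Nb] := boolP (N %| b)%Z; last exact: (wl a b).
  have Na : ~~ (N %| - a)%Z by rewrite rpredN; apply: far_zeroN Nb _; rewrite farC.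
  by apply: (wl (- b) (- a)); rewrite ?farN 1?farC ?(ord_opp Hp) // (root_opp Ve).
have fba : far N b a by rewrite farC.
wlog [m Ec] : c d f g y z y0 z0 fcd ffg pcd pfg rel / exists m, c = b + m * N.
  move=> wl; have Hb := rcoord rel b; move: Hb; rewrite (coordE N_odd) // (coord_far fba).
  have flip2 m : d = - b + m * N -> False.
    move=> E; apply: (wl (- d) (- c) f g y z) => //; rewrite ?farN ?(ord_opp Hp) //.
    - by rewrite farC.
    - by rewrite (root_opp Ve).
    by exists (- m); intlia.
  have flip3 m : g = - b + m * N -> False.
    move=> E; apply: (wl (- g) (- f) c d z y) => //; rewrite ?farN ?(ord_opp Hp) //.
    - by rewrite farC.
    - by rewrite (root_opp Ve) addrAC.
    by exists (- m); intlia.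
  have swap m : f = b + m * N -> False.
    move=> E; apply: (wl f g c d z y) => //; first by rewrite addrAC.
    by exists m.
  case: (coordP N_odd c Nb) => [m E _|m Ec|fc].
  - by apply: (wl c d f g y z) => //; exists m.
  - case: (coordP N_odd d Nb) => [k E|k E _|fd]; last 2 first.
    + exact: flip2 E.
    + case: (coordP N_odd f Nb) => [k E _|k Ef|ff]; first exact: swap E;
      case: (coordP N_odd g Nb) => [k' E|k' E _|fg]; try exact: (flip3 _ E);
      by rewrite !rmorphB /= ?rmorphN /= ?rmorph0 ?rmorph1; move: x0 y0 z0; lra.
    case: (coordP N_odd f Nb) => [k' E' _|k' Ef|ff]; first exact: swap E';
    case: (coordP N_odd g Nb) => [k'' E''|k'' E'' _|fg]; try exact: (flip3 _ E'');
    by rewrite !rmorphB /= ?rmorphN /= ?rmorph0 ?rmorph1; move: x0 y0 z0; lra.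
  case: (coordP N_odd d Nb) => [k E|k E _|fd]; last 2 first.
  - exact: flip2 E.
  - case: (coordP N_odd f Nb) => [k E _|k Ef|ff]; first exact: swap E;
    case: (coordP N_odd g Nb) => [k' E|k' E _|fg]; try exact: (flip3 _ E);
    by rewrite !rmorphB /= ?rmorphN /= ?rmorph0 ?rmorph1; move: x0 y0 z0; lra.
  case: (coordP N_odd f Nb) => [k' E' _|k' Ef|ff]; first exact: swap E';
  case: (coordP N_odd g Nb) => [k'' E''|k'' E'' _|fg]; try exact: (flip3 _ E'');
  by rewrite !rmorphB /= ?rmorphN /= ?rmorph0 ?rmorph1; move: x0 y0 z0; lra.
have {rel} rel : x *: (e b - e a) + y *: (e (d - m * N) - e b) + z *: (e g - e f) = 0.
  by rewrite -[RHS]rel -(root_shift Ve b (d - m * N) m) subrK Ec.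
have {pcd} pbd : p b (d - m * N) by rewrite -(@ord_shiftE _ _ Hp _ _ m c d) //; intlia.
have {fcd} fbd : far N b (d - m * N) by rewrite -mulNr farDr -(farD N b d m 0) -Ec mul0r addr0.
move: (d - m * N) fbd pbd rel => {c Ec m}d fbd pbd rel.
have [fad|/nearP[m [Ed|Ed]]] := boolP (far N a d).
(* [acyclic_far] requires an end point not divisible by [N]; otherwise negation turns the path into
   [- d, - b, - a]. *)
- have [Nd|Nd] := boolP (N %| d)%Z.
    have Na : ~~ (N %| a)%Z by apply: far_zeroN Nd _; rewrite farC.
    apply: (@acyclic_far y x z (- d) (- b) (- a) f g);
      rewrite ?farN ?rpredN ?(ord_opp Hp) //; try by rewrite farC.
    by rewrite !(root_opp Ve) -[RHS]rel [X in X + _]addrC.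
  exact: (@acyclic_far x y z a b d f g).
- by move: pbd rel; rewrite Ed => pbd rel; exact: (@acyclic_same_class x y z a b m f g).
have [/dvdzP[c Ea]|Na] := boolP (N %| a)%Z.
  move: pbd rel; rewrite (_ : d = a + (m - 2 * c) * N); last by intlia.
  by move=> pbd rel; exact: (@acyclic_same_class x y z a b (m - 2 * c) f g).
by move: pbd rel; rewrite Ed => pbd rel; exact: (@acyclic_reflected x y z a b m f g).
Qed.

End Acyclic.

(** * Inversion sets and biclosed sets *)

Section Roots.
Variables (R : realType) (N : int) (V : lmodType R) (e : int -> V).
Hypotheses (N_gt0 : 0 < N) (N_odd : forall k, (N %| 2 * k)%Z -> (N %| k)%Z).
Hypothesis Ve : etilde_space N e.

Lemma etilde_mulN c : e (c * N) = c%:~R *: e N.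
Proof.
have e0 : e 0 = 0.
  have := etildeN Ve 0; rewrite oppr0 => /eqP; rewrite -addr_eq0 -mulr2n.
  by rewrite -scaler_nat scaler_eq0 pnatr_eq0 => /eqP.
by rewrite -[c * N]add0r (etildeD Ve) e0 add0r.
Qed.

Lemma half_root j c : 2^-1 *: (e j - e (2 * c * N - j)) = e j - e (c * N).
Proof.
rewrite [2 * c * N - j]addrC (etildeD Ve) (etildeN Ve) etilde_mulN.
rewrite opprD opprK addrA -mulr2n scalerBr -scaler_nat !scalerA rmorphM /=.
by rewrite mulrA mulVf ?pnatr_eq0 // scale1r mul1r.
Qed.

Lemma pos_rootE v :
  pos_root N e v <-> exists i j, [/\ i < j, far N i j & v = e j - e i].
Proof.
split.
  case=> [[i [j [ij _ nij nij' ->]]]|[i [j [ij /andP[_ Nj] + ->]]]].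
    by exists i, j; split=> //; move: nij nij'; rewrite /far !eqz_mod_dvd opprK => -> ->.
  rewrite eqz_mod_dvd subr0 => /dvdzP[d E].
  exists (d * N), j; split; [by clear -E ij; lia|exact: far_zero|].
  by rewrite -half_root (_ : 2 * d * N - j = i) //; intlia.
case=> i [j [ij fij ->]].
(* The short root comes from [k] and its mirror image about [c * N]. *)
have short c k : c * N < k -> ~~ (N %| k)%Z -> pos_root N e (e k - e (c * N)).
  move=> ck Nk; right; exists (2 * c * N - k), k; split.
  - by clear Nk; lia.
  - rewrite Nk andbT; apply: contraNN Nk => /dvdzP[d E].
    by apply/dvdzP; exists (2 * c - d); intlia.
  - by rewrite eqz_mod_dvd subr0 subrK; apply/dvdzP; exists c; intlia.
  - by rewrite half_root.
have [/dvdzP[c E]|Ni] := boolP (N %| i)%Z.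
  by rewrite E; apply: short; rewrite -?E //; apply: far_zeroN fij; rewrite E dvdz_mull.
have [/dvdzP[c E]|Nj] := boolP (N %| j)%Z.
  rewrite -(root_opp Ve) E -mulNr; apply: short; last by rewrite rpredN.
  by rewrite mulNr -E ltrN2.
left; exists i, j; split=> //; first by rewrite Ni.
  by case/andP: fij; rewrite eqz_mod_dvd.
by case/andP: fij; rewrite eqz_mod_dvd opprK.
Qed.

Section Inversions.
Variables (p : rel int) (Hp : invariant_order N p).

Lemma inversionsE v :
  inversions N e p v <-> exists i j, [/\ i < j, far N i j, p j i & v = e j - e i].
Proof.
split.
  case=> i [j [/and5P[ij Ni Nj nij sij] pji ->]]; rewrite /rho.
  case: ifPn => sij0.
    move: sij0; rewrite eqz_mod_dvd subr0 => /dvdzP[d E].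
    have Ei : i = 2 * d * N - j by intlia.
    exists (d * N), j; split; [by clear -E ij; lia|exact: far_zero| |by rewrite -half_root -Ei].
    by rewrite -(ord_mid Hp) // -Ei.
  exists i, j; split=> //; rewrite /far -eqz_mod_dvd nij /=; apply/dvdzP => -[m E].
  have [d [Ed|Ed]] : exists d : int, m = 2 * d \/ m = 2 * d + 1.
    by exists (m %/ 2)%Z; intlia.
    by case/negP: sij0; rewrite eqz_mod_dvd subr0; apply/dvdzP; exists d; rewrite E Ed; intlia.
  by case/negP: sij; rewrite eqz_mod_dvd; apply/dvdzP; exists d; rewrite E Ed; intlia.
case=> i [j [ij fij pji ->]].
have short c k : c * N < k -> ~~ (N %| k)%Z -> p k (c * N) ->
    inversions N e p (e k - e (c * N)).
  move=> ck Nk pk; exists (2 * c * N - k), k; split.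
  - apply/and5P; split=> //; first by clear Nk pk; lia.
    + apply: contraNN Nk => /dvdzP[d E].
      by apply/dvdzP; exists (2 * c - d); intlia.
    + rewrite eqz_mod_dvd; apply: contraNN Nk => /dvdzP[d E]; apply: N_odd.
      by apply/dvdzP; exists (2 * c - d); intlia.
    + rewrite subrK eqz_mod_dvd; apply/dvdzP => -[d E].
      have : (2 * c - 1 - 2 * d) * N = 0 by intlia.
      by move=> /eqP; rewrite mulf_eq0 (gt_eqF N_gt0) orbF => /eqP; intlia.
  - by rewrite (ord_mid Hp).
  - rewrite /rho subrK eqz_mod_dvd subr0 (_ : 2 * c * N = c * (2 * N)); last by intlia.
    by rewrite dvdz_mull // -half_root (_ : c * (2 * N) = 2 * c * N) //; intlia.
have [/dvdzP[c E]|Ni] := boolP (N %| i)%Z.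
  by rewrite E; apply: short; rewrite -?E //; apply: far_zeroN fij; rewrite E dvdz_mull.
have [/dvdzP[c E]|Nj] := boolP (N %| j)%Z.
  rewrite -(root_opp Ve) E -mulNr; apply: short; last 2 first.
  - by rewrite rpredN.
  - by rewrite mulNr -E (ord_opp Hp).
  by rewrite mulNr -E ltrN2.
case/andP: (fij) => nij sij.
have two m : (2 * N %| m)%Z -> (N %| m)%Z by apply: dvdz_trans; rewrite dvdz_mull.
exists i, j; split=> //.
  apply/and5P; split; rewrite ?eqz_mod_dvd //.
  apply: contraNN sij => /two; rewrite -[X in _ -> (_ %| X)%Z](subrK N) => H.
  by rewrite rpredD ?dvdzz.
rewrite /rho eqz_mod_dvd subr0; case: ifP => // /two.
by rewrite (negbTE sij).
Qed.

Lemma inversions_root i j : i < j -> far N i j -> inversions N e p (e j - e i) <-> p j i.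
Proof.
move=> ij fij; rewrite inversionsE; split=> [[k [l [kl fkl plk E]]]|pji]; last by exists i, j.
apply/negPn/negP; rewrite -(ord_tot Hp) ?gt_eqF // => pij.
have flk : far N l k by rewrite farC.
(* A root can come from several pairs. If two of them were ordered differently, the root and its
   opposite would both follow [p]; one is counted as 1 + 1 to make three terms. *)
apply: (@ord_acyclic R N V e N_gt0 N_odd Ve p Hp 1 1 2 l k l k i j) => //.
by rewrite E -!scalerDl -(opprB (e l)) scalerN addNr.
Qed.

(** A violation of either condition is a vanishing positive combination of three roots, all oriented
    along [p]. *)
Lemma inversions_biclosed : biclosed N e (inversions N e p).
Proof.
split.
  by move=> v /inversionsE[i [j [ij fij _ ->]]]; apply/pos_rootE; exists i, j.
move=> _ _ _ /pos_rootE[i [j [ij fij ->]]] /pos_rootE[k [l [kl fkl ->]]]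
  /pos_rootE[s [t [st fst ->]]] [a [b [a0 b0 E]]].
rewrite !inversions_root //.
have acy := @ord_acyclic R N V e N_gt0 N_odd Ve p Hp.
split.
  move=> pji plk; apply/negPn/negP; rewrite -(ord_tot Hp) ?gt_eqF // => pst.
  apply: (acy a b 1 j i l k s t) => //; try by rewrite farC.
  rewrite scale1r E -(opprB (e j)) -(opprB (e l)) !scalerN -opprD.
  by rewrite addNr.
move=> pji plk pts; apply: (acy a b 1 i j k l t s) => //; try by rewrite farC.
- by apply/negPn/negP; rewrite -(ord_tot Hp) // lt_eqF.
- by apply/negPn/negP; rewrite -(ord_tot Hp) // lt_eqF.
by rewrite scale1r -E -(opprB (e t)) subrr.
Qed.

End Inversions.

Lemma inversions_eq p q : invariant_order N p -> invariant_order N q ->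
  (inversions N e p = inversions N e q <-> same_up_to_moves N p q).
Proof.
move=> Hp Hq; split=> [E|].
  apply: same_far_moves => // i j fij.
  wlog ij : i j fij / i < j.
    move=> wl; have := far_neq fij; rewrite neq_lt => /orP[|ji]; first exact: wl.
    by rewrite (ord_tot Hp (i := j)) ?lt_eqF // (ord_tot Hq (i := j)) ?lt_eqF //
       (wl j i) // farC.
  rewrite (ord_tot Hp (i := j)) ?gt_eqF // (ord_tot Hq (i := j)) ?gt_eqF //.
  congr (~~ _); apply/idP/idP.
    by move=> /(inversions_root Hp ij fij); rewrite E => /(inversions_root Hq ij fij).
  by move=> /(inversions_root Hq ij fij); rewrite -E => /(inversions_root Hp ij fij).
elim=> {Hp Hq p q} [p q pq|//|p q _ -> //|p q s _ -> _ -> //].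
by apply/seteqP; split=> v [i [j [dij pji ->]]]; exists i, j; split => //;
  move: pji; rewrite (move_rho_dom pq dij).
Qed.

(** * The tournament of a biclosed set *)

Section Biclosed.
Variables (B : set V) (HB : biclosed N e B).

Definition biclosed_rel : rel int := fun i j =>
  `[< if i < j then ~ B (e j - e i) else B (e i - e j) >].

Let r := biclosed_rel.

Lemma biclosed_relP i j : far N i j -> r i j ->
  (i < j /\ pos_root N e (e j - e i) /\ ~ B (e j - e i)) \/
  (j < i /\ pos_root N e (- (e j - e i)) /\ B (- (e j - e i))).
Proof.
move=> fij; have := far_neq fij; rewrite neq_lt => /orP[ij|ji] /asboolP.
  by rewrite ij => nB; left; split=> //; split=> //; apply/pos_rootE; exists i, j.
rewrite ltNge ltW //= opprB => Bij; right; split=> //; split=> //.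
by apply/pos_rootE; exists j, i; rewrite farC.
Qed.

(** Three roots of one sign are excluded by the height. Otherwise, moving the root of the
    exceptional sign to the other side contradicts one of the two conditions on [B]. *)
Lemma biclosed_rel_acyclic : acyclic_on_roots N e r.
Proof.
have core (x y z : R) (u v w : V) : 0 < x -> 0 < y -> 0 < z ->
    pos_root N e u -> pos_root N e v -> pos_root N e w -> x *: u + y *: v = z *: w ->
    (B u -> B v -> B w) /\ (~ B u -> ~ B v -> ~ B w).
  move=> x0 y0 z0 pu pv pw E; apply: HB.2 => //.
  exists (z^-1 * x), (z^-1 * y); split; rewrite ?mulr_gt0 ?invr_gt0 //.
  by rewrite -!scalerA -scalerDr E scalerA mulVf ?scale1r // gt_eqF.
move=> x y z a b c d f g x0 y0 z0 fab fcd ffg rab rcd rfg rel.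
have h := relation_height Ve rel.
have i0 (u v : int) : u < v -> 0 < (v - u)%:~R :> R by rewrite ltr0z subr_gt0.
have i1 (u v : int) : v < u -> (v - u)%:~R < 0 :> R by rewrite ltrz0 subr_lt0.
move: rel; case: (biclosed_relP fab rab) => -[ab [pab Bab]];
  case: (biclosed_relP fcd rcd) => -[cd [pcd Bcd]];
  case: (biclosed_relP ffg rfg) => -[fg [pfg Bfg]];
  move: pab Bab pcd Bcd pfg Bfg;
  set u := e b - e a; set v := e d - e c; set w := e g - e f => pab Bab pcd Bcd pfg Bfg rel.
- by have := i0 _ _ ab; have := i0 _ _ cd; have := i0 _ _ fg; nra.
- have [|_] := core x y z u v (- w) x0 y0 z0 pab pcd pfg; last by apply.
  by rewrite scalerN; apply/eqP; rewrite -addr_eq0 rel.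
- have [|_] := core x z y u w (- v) x0 z0 y0 pab pfg pcd; last by apply.
  by rewrite scalerN; apply/eqP; rewrite -addr_eq0 addrAC rel.
- have [|+ _] := core y z x (- v) (- w) u y0 z0 x0 pcd pfg pab; last by move=> /(_ Bcd Bfg).
  by rewrite !scalerN -opprD; apply/esym/eqP; rewrite -addr_eq0 addrA rel.
- have [|_] := core y z x v w (- u) y0 z0 x0 pcd pfg pab; last by apply.
  by rewrite scalerN; apply/eqP; rewrite -addr_eq0 addrC addrA rel.
- have [|+ _] := core x z y (- u) (- w) v x0 z0 y0 pab pfg pcd; last by move=> /(_ Bab Bfg).
  by rewrite !scalerN -opprD; apply/esym/eqP; rewrite -addr_eq0 addrCA addrA rel.
- have [|+ _] := core x y z (- u) (- v) w x0 y0 z0 pab pcd pfg; last by move=> /(_ Bab Bcd).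
  by rewrite !scalerN -opprD; apply/esym/eqP; rewrite -addr_eq0 addrC rel.
by have := i1 _ _ ab; have := i1 _ _ cd; have := i1 _ _ fg; nra.
Qed.

Lemma biclosed_rel_far : far_order N r.
Proof.
have tot i j : far N i j -> r j i = ~~ r i j.
  move=> fij; have := far_neq fij; rewrite /r /biclosed_rel neq_lt => /orP[ij|ij].
    by rewrite ij ltNge ltW //= asbool_neg negbK.
  by rewrite ij [i < j]ltNge ltW //= asbool_neg.
split=> //.
- by move=> i j c fij; rewrite /r /biclosed_rel ltrD2r !(root_shift Ve).
- by move=> i j fij; rewrite /r /biclosed_rel ltrN2 !(root_opp Ve).
- move=> i j k fij fjk fik rij rjk; apply/negPn/negP; rewrite -tot // => rki.
  apply: (@biclosed_rel_acyclic 1 1 1 i j j k k i) => //; first by rewrite farC.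
  by rewrite !scale1r [X in X + _]addrC !subrKA subrr.
move=> i k fik h1 h2 h3 l12 l23 /= E.
have fk h : far N i (k + h * N) by rewrite farDr.
have fk' h : far N (k + h * N) i by rewrite farC.
have d12 : 0 < (h2 - h1)%:~R :> R by rewrite ltr0z subr_gt0.
have d23 : 0 < (h3 - h2)%:~R :> R by rewrite ltr0z subr_gt0.
have d13 : 0 < (h3 - h1)%:~R :> R by rewrite ltr0z subr_gt0 (lt_trans l12).
(* The vectors [e (k + h * N) - e i] are affine in [h], so the middle one is a barycenter of the
   outer two. *)
have rel : (h3 - h2)%:~R *: (e (k + h1 * N) - e i) + (h2 - h1)%:~R *: (e (k + h3 * N) - e i)
    = (h3 - h1)%:~R *: (e (k + h2 * N) - e i).
  rewrite !(etildeD Ve) ![_ + _ *: e N - _]addrAC !(scalerDr _ (_ - _)) addrACA -scalerDl.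
  rewrite !scalerA -scalerDl -!rmorphM -!rmorphD.
  by congr (_%:~R *: _ + _%:~R *: _); ring.
case e1 : (r i (k + h1 * N)) E; case e2 : (r i (k + h2 * N)) => // /esym e3; exfalso.
  apply: (@biclosed_rel_acyclic _ _ _ i (k + h1 * N) i (k + h3 * N) (k + h2 * N) i
    d23 d12 d13) => //.
    by rewrite tot // e2.
  by rewrite rel -scalerDr addrC subrKA subrr scaler0.
apply: (@biclosed_rel_acyclic _ _ _ (k + h1 * N) i (k + h3 * N) i i (k + h2 * N)
  d23 d12 d13) => //.
- by rewrite tot // e1.
- by rewrite tot // e3.
by rewrite -rel -!(opprB _ (e i)) !scalerN -opprD addNr.
Qed.

(** By [inversionsE] only far pairs matter, and on these [extension] keeps the tournament of [B]. *)
Lemma biclosed_inversions :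
  exists2 p, invariant_order N p & B = inversions N e p.
Proof.
have Hext := extension_invariant biclosed_rel_far.
exists (extension N r) => //.
have rE i j : i < j -> r j i <-> B (e j - e i).
  by move=> ij; rewrite /r /biclosed_rel ltNge ltW //=; split=> /asboolP.
apply/seteqP; split=> v.
  move=> Bv; have /pos_rootE[i [j [ij fij E]]] := HB.1 v Bv.
  apply/(inversionsE Hext); exists i, j; split=> //.
  by rewrite extension_far 1?farC //; apply/rE => //; rewrite -E.
move=> /(inversionsE Hext)[i [j [ij fij + ->]]].
by rewrite extension_far 1?farC // => /rE; apply.
Qed.

End Biclosed.
End Roots.

Lemma dvd_double_period n k : (period n %| 2 * k)%Z -> (period n %| k)%Z.
Proof.
(* With [N = 2 * n + 1] and [2 * k = q * N], one has [k = k * N - n * (2 * k)]. *)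
move=> /dvdzP[q E]; apply/dvdzP; exists (k - q * n%:Z).
by move: E; rewrite /period; nia.
Qed.

Theorem theorem5p12 (R : realType) (n : nat) (n_ge1 : (1 <= n)%N)
    (V : lmodType R) (e : int -> V) (Ve : etilde_space (period n) e) :
  [/\ (forall p : rel int, invariant_order (period n) p ->
         biclosed (period n) e (inversions (period n) e p)),
      (forall B : set V, biclosed (period n) e B ->
         exists2 p : rel int, invariant_order (period n) p
           & B = inversions (period n) e p)
    & (forall p q : rel int,
         invariant_order (period n) p -> invariant_order (period n) q ->
         (inversions (period n) e p = inversions (period n) e q <->
          same_up_to_moves (period n) p q))].
Proof.
have N_gt0 : 0 < period n by rewrite /period; lia.
have N_odd := @dvd_double_period n.
split.
- by move=> p; exact: inversions_biclosed.
- by move=> B; exact: biclosed_inversions.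
- by move=> p q; exact: inversions_eq.
Qed.
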